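(* Let $H_i,H:[0,T]\times\mathbb{R}^n\times\mathbb{R}^n\to\mathbb{R}$, $i\in\mathbb{N}$, be continuous and admissible (see context). Let $(\mathbb{R}^{n+1},f_i,l_i)$ and $(\mathbb{R}^{n+1},f,l)$ be the canonical noncompact representations of $H_i$ and $H$, respectively (see context). If $$\sup_{(t,x,p)\in[0,T]\times B_R\times\mathbb{R}^n}\frac{|H_i(t,x,p)-H(t,x,p)|}{1+|p|}\xrightarrow[i\to\infty]{}0\qquad\text{for all } R>0,$$ then for all $R>0$ $$\sup_{(t,x,a)\in[0,T]\times B_R\times\mathbb{R}^{n+1}}|f_i(t,x,a)-f(t,x,a)|\xrightarrow[i\to\infty]{}0,\qquad \sup_{(t,x,a)\in[0,T]\times B_R\times\mathbb{R}^{n+1}}|l_i(t,x,a)-l(t,x,a)|\xrightarrow[i\to\infty]{}0.$$ Furthermore, if there are measurable $c_i,c:[0,T]\to[0,\infty)$ with $|H_i(t,x,p)-H_i(t,x,q)|\le c_i(t)(1+|x|)|p-q|$ and $|H(t,x,p)-H(t,x,q)|\le c(t)(1+|x|)|p-q|$ for all $t\in[0,T]$, $x,p,q\in\mathbb{R}^n$, $i\in\mathbb{N}$, then $|f_i(t,x,a)|\le c_i(t)(1+|x|)$ and $|f(t,x,a)|\le c(t)(1+|x|)$ for all $t\in[0,T]$, $x\in\mathbb{R}^n$, $a\in\mathbb{R}^{n+1}$, $i\in\mathbb{N}$.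
   Context: $|\cdot|$ is the Euclidean norm, $B(y,r)$ is the closed ball with center $y$ and radius $r\ge0$, $B_R$ is the closed ball in $\mathbb{R}^n$ centered at $0$ with radius $R$, $d(y,K):=\inf_{z\in K}|y-z|$. A null set is a set of Lebesgue measure zero. A modulus is a function $w:[0,T]\times[0,\infty)\to[0,\infty)$ such that $w(\cdot,r)$ is measurable for every $r\ge0$ and, for every $t$, $w(t,\cdot)$ is nondecreasing, continuous, subadditive and $w(t,0)=0$. A function $H:[0,T]\times\mathbb{R}^n\times\mathbb{R}^n\to\mathbb{R}$ is called admissible if $H(\cdot,x,p)$ is measurable for all $(x,p)$, $H(t,\cdot,\cdot)$ is continuous for every $t$, $H(t,x,\cdot)$ is convex for every $(t,x)$, and for every $R>0$ there are a measurable $k_R:[0,T]\to[0,\infty)$, a modulus $w_R$ and a null set $\mathcal{N}_R$ such that $|H(t,x,p)-H(t,y,p)|\le k_R(t)|p||x-y|+w_R(t,|x-y|)$ for all $t\in[0,T]\setminus\mathcal{N}_R$, $x,y\in B_R$, $p\in\mathbb{R}^n$. (These data may be different for each $H_i$.) Steiner point: for a nonempty convex compact $K\subset\mathbb{R}^m$ let $\sigma(K,p):=\max_{x\in K}\langle p,x\rangle$, and let $m(\partial\sigma(K,p))$ be the element of minimal norm of the subdifferential of the convex function $\sigma(K,\cdot)$ at $p$. Then $s_m(K):=\frac{1}{\mathrm{vol}(B)}\int_{B}m(\partial\sigma(K,p))\,dp\in K$, where $B$ is the closed unit ball of $\mathbb{R}^m$. Canonical noncompact representation: for admissible $H$ put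 $L(t,x,v):=\sup_{p\in\mathbb{R}^n}\{\langle v,p\rangle-H(t,x,p)\}$ and $E_L(t,x):=\{(v,\eta)\in\mathbb{R}^n\times\mathbb{R}: L(t,x,v)\le\eta\}$, which is a nonempty closed convex subset of $\mathbb{R}^{n+1}$. For $a\in\mathbb{R}^{n+1}$ define $e(t,x,a):=s_{n+1}\big(E_L(t,x)\cap B(a,2d(a,E_L(t,x)))\big)\in\mathbb{R}^{n+1}$, and define $f(t,x,a)\in\mathbb{R}^n$, $l(t,x,a)\in\mathbb{R}$ by $e(t,x,a)=(f(t,x,a),l(t,x,a))$. The triple $(\mathbb{R}^{n+1},f,l)$ is the canonical noncompact representation of $H$. *)

(* Defs.v *)
From HB Require Import structures.
From mathcomp Require Import all_boot all_order all_algebra.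
From mathcomp Require Import all_classical all_reals all_analysis.
From mathcomp Require Import measurable_realfun.
Set Implicit Arguments.
Unset Strict Implicit.
Unset Printing Implicit Defensive.
Import Order.TTheory GRing.Theory Num.Theory.
Import numFieldNormedType.Exports.
Local Open Scope classical_set_scope.
Local Open Scope ring_scope.

Section euclidean.
Context {R : realType}.

Definition dotv m (u v : 'rV[R]_m) : R := \sum_i u 0 i * v 0 i.

(* The library norm on 'rV[R]_m is the sup norm, hence this definition; both
   norms induce the topology used for continuity below. *)
Definition enorm m (u : 'rV[R]_m) : R := Num.sqrt (\sum_i u 0 i ^+ 2).

Definition cball m (y : 'rV[R]_m) (r : R) : set 'rV[R]_m :=
  [set z | enorm (z - y) <= r].

Definition edist m (y : 'rV[R]_m) (K : set 'rV[R]_m) : R :=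
  inf [set enorm (y - z) | z in K].

End euclidean.

(* m-dimensional Lebesgue measure, by iterated products with the Lebesgue
   measure of the line; it lives on m.-tuple, which carries the product
   sigma-algebra. *)
Section lebesgue_tuple.
Context {R : realType}.
Local Notation RT := (measurableTypeR R).

Definition cons_pair m (p : RT * m.-tuple RT) : m.+1.-tuple RT :=
  [the m.+1.-tuple RT of p.1 :: p.2].

Definition uncons_pair m (t : m.+1.-tuple RT) : RT * m.-tuple RT :=
  (thead t, [tuple of behead t]).

Lemma measurable_cons_pair m : measurable_fun setT (@cons_pair m).
Proof.
by apply: measurable_cons; [exact: measurable_fst|exact: measurable_snd].
Qed.

Lemma measurable_uncons_pair m : measurable_fun setT (@uncons_pair m).
Proof.
apply/measurable_fun_pairP; split; last exact: measurable_behead.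
exact: measurable_tnth.
Qed.

Lemma cons_pairK m : cancel (@cons_pair m) (@uncons_pair m).
Proof. by case=> x t; congr pair; apply: val_inj. Qed.

Section cons_measure.
Local Open Scope ereal_scope.
Context m (mu : {sigma_finite_measure set (m.-tuple RT) -> \bar R}).

Definition cons_measure : set (m.+1.-tuple RT) -> \bar R :=
  pushforward (@lebesgue_measure R \x mu) (@cons_pair m).

Let measurable_preimage_cons A :
  measurable A -> measurable (@cons_pair m @^-1` A).
Proof.
by move=> mA; rewrite -[X in measurable X]setTI; exact: measurable_cons_pair.
Qed.

Let cons_measure0 : cons_measure set0 = 0.
Proof. by rewrite /cons_measure /pushforward preimage_set0 measure0. Qed.

Let cons_measure_ge0 A : 0 <= cons_measure A.
Proof. by rewrite /cons_measure /pushforward; exact: measure_ge0. Qed.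

Let cons_measure_sigma_additive : semi_sigma_additive cons_measure.
Proof.
move=> F mF tF mUF; rewrite /cons_measure /pushforward preimage_bigcup.
apply: measure_semi_sigma_additive.
- by move=> i; exact: measurable_preimage_cons.
- apply/trivIsetP => /= i j _ _ ij; rewrite -preimage_setI.
  by move/trivIsetP : tF => /(_ _ _ _ _ ij) ->//; rewrite preimage_set0.
- by rewrite -preimage_bigcup; exact: measurable_preimage_cons.
Qed.

HB.instance Definition _ := isMeasure.Build _ _ _ cons_measure
  cons_measure0 cons_measure_ge0 cons_measure_sigma_additive.

Let cons_measure_sigma_finite : sigma_finite setT cons_measure.
Proof.
have /sigma_finiteP[F [TF ndF Foo]] := sigma_finiteT (@lebesgue_measure R).
have /sigma_finiteP[G [TG ndG Goo]] := sigma_finiteT mu.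
exists (fun i => @uncons_pair m @^-1` (F i `*` G i)).
  rewrite -preimage_bigcup [X in _ @^-1` X](_ : _ = setT) ?preimage_setT//.
  apply/seteqP; split => // -[x t] _.
  have [i _ Fx] : (\bigcup_i F i) x by rewrite -TF.
  have [j _ Gt] : (\bigcup_i G i) t by rewrite -TG.
  exists (maxn i j) => //; split => /=.
    by move: x Fx; exact/subsetPset/ndF/leq_maxl.
  by move: t Gt; exact/subsetPset/ndG/leq_maxr.
move=> i; have [mF Fi] := Foo i; have [mG Gi] := Goo i.
split; first by rewrite -[X in measurable X]setTI;
  apply: measurable_uncons_pair => //; exact: measurableX.
rewrite /cons_measure /pushforward -comp_preimage.
rewrite (_ : _ \o _ = id); last by apply/funext => p /=; rewrite cons_pairK.
by rewrite preimage_id product_measure1E// lte_mul_pinfty// ge0_fin_numE.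
Qed.

HB.instance Definition _ :=
  Measure_isSigmaFinite.Build _ _ _ cons_measure cons_measure_sigma_finite.

End cons_measure.

Fixpoint lebesgue_tuple m : {sigma_finite_measure set (m.-tuple RT) -> \bar R} :=
  match m with
  | 0 => \d_ [tuple]
  | m'.+1 => cons_measure (lebesgue_tuple m')
  end.

Definition rV_of_tuple m (t : m.-tuple RT) : 'rV[R]_m := \row_i tnth t i.

End lebesgue_tuple.

Section steiner.
Context {R : realType}.

Definition support_fun m (K : set 'rV[R]_m) (p : 'rV[R]_m) : R :=
  sup [set dotv p x | x in K].

Definition subdiff m (g : 'rV[R]_m -> R) (p : 'rV[R]_m) : set 'rV[R]_m :=
  [set z | forall q, g p + dotv z (q - p) <= g q].

Definition min_norm_elt m (A : set 'rV[R]_m) : 'rV[R]_m :=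
  xget 0 [set z | A z /\ forall z', A z' -> enorm z <= enorm z'].

Definition steiner m (K : set 'rV[R]_m) : 'rV[R]_m :=
  let B := @rV_of_tuple R m @^-1` cball 0 1 in
  \row_i ((fine (lebesgue_tuple m B))^-1 *
    \int[lebesgue_tuple m]_(t in B)
      min_norm_elt (subdiff (support_fun K) (rV_of_tuple t)) 0 i).

End steiner.

Section hamiltonian.
Context {R : realType}.

(* The sigma-algebra of measurableTypeR is the Borel one; measurability in
   time is meant with respect to its Lebesgue completion. *)
Definition lebesgue_measurable_fun (D : set R) (f : R -> R) : Prop :=
  @measurable_fun _ _
    (g_sigma_algebraType (completed_algebra_gen (@lebesgue_measure R)))
    (measurableTypeR R) D f.

Definition modulus (T : R) (w : R -> R -> R) : Prop :=
  [/\ forall t r, t \in `[0, T] -> 0 <= r -> 0 <= w t r,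
      forall r, 0 <= r -> lebesgue_measurable_fun `[0, T] (w ^~ r) &
      forall t, t \in `[0, T] ->
        [/\ {in `[0, +oo[ &, {homo w t : r s / r <= s}},
            {within `[0, +oo[, continuous (w t)},
            {in `[0, +oo[ &, forall r s, w t (r + s) <= w t r + w t s} &
            w t 0 = 0]].

Definition admissible n (T : R) (H : R -> 'rV[R]_n -> 'rV[R]_n -> R) : Prop :=
  [/\ forall x p, lebesgue_measurable_fun `[0, T] (fun t => H t x p),
      forall t, t \in `[0, T] ->
        continuous (fun z : 'rV[R]_n * 'rV[R]_n => H t z.1 z.2),
      forall t x, t \in `[0, T] -> convex_function setT (H t x) &
      forall r, 0 < r -> exists k w N,
        [/\ lebesgue_measurable_fun `[0, T] k,
            forall t, t \in `[0, T] -> 0 <= k t,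
            modulus T w,
            (@lebesgue_measure R).-negligible N &
            forall t x y p, t \in `[0, T] -> ~ N t -> cball 0 r x ->
              cball 0 r y ->
              `|H t x p - H t y p| <=
                k t * enorm p * enorm (x - y) + w t (enorm (x - y))]].

Definition lagrangian n (H : R -> 'rV[R]_n -> 'rV[R]_n -> R) (t : R)
    (x v : 'rV[R]_n) : \bar R :=
  ereal_sup [set (dotv v p - H t x p)%:E | p in [set: 'rV[R]_n]].

(* R^n x R is 'rV[R]_(n + 1), the last coordinate being the real component. *)
Definition epi_lagrangian n (H : R -> 'rV[R]_n -> 'rV[R]_n -> R) (t : R)
    (x : 'rV[R]_n) : set 'rV[R]_(n + 1) :=
  [set u | (lagrangian H t x (lsubmx u) <= (rsubmx u 0 0)%:E)%E].

Section canonical.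
Context n (H : R -> 'rV[R]_n -> 'rV[R]_n -> R) (t : R) (x : 'rV[R]_n).

Definition canonical_e (a : 'rV[R]_(n + 1)) : 'rV[R]_(n + 1) :=
  let E := epi_lagrangian H t x in steiner (E `&` cball a (2 * edist a E)).

Definition canonical_f (a : 'rV[R]_(n + 1)) : 'rV[R]_n :=
  lsubmx (canonical_e a).

Definition canonical_l (a : 'rV[R]_(n + 1)) : R := rsubmx (canonical_e a) 0 0.

End canonical.

End hamiltonian.

(* Main.v *)
Require Import Defs.
From mathcomp Require Import all_boot all_order all_algebra.
From mathcomp Require Import all_classical all_reals all_analysis.
From mathcomp Require Import measurable_realfun ring lra.
Import Order.TTheory GRing.Theory Num.Theory.
Import numFieldNormedType.Exports.

(** At a fixed (t, x) the Hamiltonian is a continuous convex function h of p,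
    and the value of the canonical representation at a is obtained from h in
    three steps, each of them Lipschitz in a sense uniform in t, x and a.

    From h to the epigraph E of its conjugate.  If two such functions differ by
    at most e (1 + |p|) then their conjugate epigraphs are at Hausdorff distance
    at most 2 e ([conj_epi_near]): the support functions of the epigraphs are
    the perspectives of h, and the hypothesis bounds their difference on unit
    vectors.  The argument projects a point of one epigraph onto the other and
    uses affine minorants of h ([affine_minorant]).

    From E to its intersection with the ball of centre a and radius twice the
    distance from a to E, which multiplies Hausdorff distances by at most 10
    ([near_truncate]).

    From a compact convex set K to its Steiner point
    ([steiner_coord_lipschitz]).  Here the Lipschitz constant must not depend on
    the size of K, because a ranges over the whole space.  The integrand, the
    element of least norm in the subdifferential of the support function, is
    the limit of the projections of k p onto K ([cproj_cvg_sel]), which makes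
    it measurable; and these projections are the gradients of the Moreau
    envelopes of the support function.  By Fubini, the integral over the unit
    ball of a partial derivative is controlled by the values of the function at
    the ends of chords ([ball_gradient]), and the envelopes of two sets at
    Hausdorff distance h differ on the unit ball by at most h up to a term that
    vanishes as k tends to infinity.

    For the bound on the velocity, all points of E have a velocity of norm at
    most the Lipschitz constant of h ([conj_epi_lsubmx_le]), and the Steiner
    point is an average of points of E ([dotv_steiner_le]). *)

Set Implicit Arguments.
Unset Strict Implicit.
Unset Printing Implicit Defensive.
Local Open Scope classical_set_scope.
Local Open Scope ring_scope.

(** * The Euclidean norm and its topology *)

Section Euclid.
Context {R : realType} {m : nat}.
Implicit Types (u v w x y z : 'rV[R]_m) (a c : R).

Lemma dotvC u v : dotv u v = dotv v u.
Proof. by apply: eq_bigr => i _; rewrite mulrC. Qed.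

Lemma dotvDl u v w : dotv (u + v) w = dotv u w + dotv v w.
Proof. by rewrite -big_split; apply: eq_bigr => i _; rewrite mxE mulrDl. Qed.

Lemma dotvZl c u v : dotv (c *: u) v = c * dotv u v.
Proof.
by rewrite /dotv mulr_sumr; apply: eq_bigr => i _; rewrite mxE mulrA.
Qed.

Lemma dotvNl u v : dotv (- u) v = - dotv u v.
Proof. by rewrite -scaleN1r dotvZl mulN1r. Qed.

Lemma dotvDr u v w : dotv w (u + v) = dotv w u + dotv w v.
Proof. by rewrite dotvC dotvDl !(dotvC w). Qed.

Lemma dotvZr c u v : dotv v (c *: u) = c * dotv v u.
Proof. by rewrite dotvC dotvZl (dotvC v). Qed.

Lemma dotvNr u v : dotv v (- u) = - dotv v u.
Proof. by rewrite dotvC dotvNl (dotvC v). Qed.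

Lemma dotv0r u : dotv u 0 = 0.
Proof. by rewrite -(scale0r 0) dotvZr mul0r. Qed.

Definition dotvE := (dotvDl, dotvDr, dotvNl, dotvNr, dotvZl, dotvZr).

Lemma dotv_ge0 u : 0 <= dotv u u.
Proof. by apply: sumr_ge0 => i _; rewrite -expr2 sqr_ge0. Qed.

Lemma enorm_ge0 u : 0 <= enorm u.
Proof. exact: sqrtr_ge0. Qed.

Lemma enorm_sqr u : enorm u ^+ 2 = dotv u u.
Proof.
rewrite /enorm sqr_sqrtr; last by apply: sumr_ge0 => i _; exact: sqr_ge0.
by apply: eq_bigr => i _; rewrite expr2.
Qed.

Lemma dotv_eq0 u : dotv u u <= 0 -> u = 0.
Proof.
move=> u0; have /eqP : dotv u u = 0 by apply/eqP; rewrite eq_le u0 dotv_ge0.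
rewrite psumr_eq0; last by move=> i _; rewrite -expr2 sqr_ge0.
move=> /allP u_0; apply/rowP => i; rewrite mxE.
by have := u_0 i (mem_index_enum _); rewrite /= mulf_eq0 orbb => /eqP.
Qed.

Lemma enorm0 : enorm (0 : 'rV[R]_m) = 0.
Proof.
by apply/eqP; rewrite -sqrf_eq0 enorm_sqr dotv0r.
Qed.

Lemma enorm_eq0 u : enorm u <= 0 -> u = 0.
Proof.
move=> u0; apply: dotv_eq0; rewrite -enorm_sqr.
have -> : enorm u = 0 by apply/eqP; rewrite eq_le u0 enorm_ge0.
by rewrite expr0n.
Qed.

Lemma enorm_leE u c : 0 <= c -> (enorm u <= c) = (dotv u u <= c ^+ 2).
Proof. by move=> c0; rewrite -enorm_sqr ler_sqr ?nnegrE ?enorm_ge0. Qed.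

Lemma enormZ c u : enorm (c *: u) = `|c| * enorm u.
Proof.
apply/eqP; rewrite -(@eqrXn2 _ 2) ?nnegrE ?mulr_ge0 ?enorm_ge0//.
by rewrite exprMn !enorm_sqr !dotvE real_normK ?num_real// mulrA expr2.
Qed.

Lemma enormN u : enorm (- u) = enorm u.
Proof. by rewrite -scaleN1r enormZ normrN1 mul1r. Qed.

Lemma enormB u v : enorm (u - v) = enorm (v - u).
Proof. by rewrite -enormN opprB. Qed.

Lemma dotv_le_enorm u v : dotv u v <= enorm u * enorm v.
Proof.
have [u0|u0] := leP (enorm u) 0.
  by rewrite (enorm_eq0 u0) enorm0 mul0r dotvC dotv0r.
have := dotv_ge0 (enorm v *: u - enorm u *: v).
rewrite !dotvE -!enorm_sqr (dotvC v u).
have [v0|v0] := leP (enorm v) 0.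
  by rewrite (enorm_eq0 v0) enorm0 mulr0 dotv0r.
move=> h; have uv0 := mulr_gt0 u0 v0.
rewrite -(ler_pM2l uv0); nra.
Qed.

Lemma ler_enormD u v : enorm (u + v) <= enorm u + enorm v.
Proof.
rewrite enorm_leE ?addr_ge0 ?enorm_ge0// !dotvE -!enorm_sqr (dotvC v u).
by have := dotv_le_enorm u v; nra.
Qed.

Lemma ler_enorm_add u v w : enorm (u - w) <= enorm (u - v) + enorm (v - w).
Proof. by rewrite -(subrKA v u); exact: ler_enormD. Qed.

Lemma norm_coord_le_enorm u i : `|u 0 i| <= enorm u.
Proof.
rewrite -ler_sqr ?nnegrE ?enorm_ge0// enorm_sqr real_normK ?num_real//.
rewrite /dotv (bigD1 i)//= -expr2 lerDl.
by apply: sumr_ge0 => j _; rewrite -expr2 sqr_ge0.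
Qed.

Lemma dotv_continuous u : continuous (dotv u).
Proof.
apply: continuous_big => [|i _ x]; first exact: add_continuous.
apply: (continuous_comp (@coord_continuous R 1 m 0 i x)).
exact: mulrl_continuous.
Qed.

Lemma enorm_continuous : continuous (@enorm R m).
Proof.
move=> x; apply: continuous_comp; last exact: sqrt_continuous.
apply: continuous_big => [|i _ y]; first exact: add_continuous.
exact: (@continuous_comp _ _ _ (fun u : 'rV[R]_m => u 0 i)
  (fun a : R => a ^+ 2) y
  (@coord_continuous R 1 m 0 i y) (@exprn_continuous R 2 _)).
Qed.

Lemma closed_dotv_le u c : closed [set x | dotv u x <= c].
Proof.
apply: (@closed_comp _ _ (dotv u) [set y | y <= c]); last exact: closed_le.
by move=> x _; exact: dotv_continuous.
Qed.

Lemma enormB_continuous y : continuous (fun x => enorm (x - y)).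
Proof.
move=> x; apply: (@continuous_comp _ _ _ (fun z => z - y)).
  exact: (@cvgB R 'rV[R]_m _ (nbhs x) _ id (fun=> y) x y cvg_id (cvg_cst y)).
exact: enorm_continuous.
Qed.

Lemma near_enorm x c : 0 < c -> \forall y \near x, enorm (y - x) < c.
Proof.
move=> c0; have := @enormB_continuous x x; rewrite /continuous_at subrr enorm0.
move=> /cvgrPdist_lt /(_ c c0).
apply: (@filterS _ (nbhs x) (nbhs_filter x)) => y.
by rewrite sub0r normrN ger0_norm ?enorm_ge0.
Qed.

Lemma norm_le_enorm u : `|u| <= enorm u.
Proof.
rewrite /Num.Def.normr /= mx_normrE; apply: bigmax_le => [|[i j] _ /=].
  exact: enorm_ge0.
by rewrite ord1; exact: norm_coord_le_enorm.
Qed.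

Lemma closed_cball y c : closed (cball y c).
Proof.
apply: (@closed_comp _ _ (fun z => enorm (z - y)) [set t | t <= c]).
  by move=> x _; exact: enormB_continuous.
exact: closed_le.
Qed.

Lemma compact_cball y c : compact (cball y c).
Proof.
apply: bounded_closed_compact; last exact: closed_cball.
exists (`|y| + `|c|); split; first exact: num_real.
move=> M yM x /= xy; rewrite (le_trans _ (ltW yM))//.
rewrite -(subrK y x) addrC (le_trans (ler_normD _ _))// lerD2l.
by rewrite (le_trans (norm_le_enorm _))// (le_trans xy)// ler_norm.
Qed.

End Euclid.

Lemma enorm_cvg (R : realType) m (T : Type) (F : set_system T) (FF : Filter F)
    (f : T -> 'rV[R]_m) (y : 'rV[R]_m) :
  (forall e : R, 0 < e -> \forall x \near F, enorm (f x - y) <= e) ->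
  f x @[x --> F] --> y.
Proof.
move=> h; apply/cvgrPdist_le => e e0; have := h e e0; apply: filterS => x.
by apply: le_trans; rewrite distrC; exact: norm_le_enorm.
Qed.

(** Continuity refers to the sup norm, which the Euclidean norm dominates in
    the codomain and which controls it continuously in the domain. *)
Lemma enorm_lipschitz_continuous (R : realType) m p (c : R)
    (f : 'rV[R]_m -> 'rV[R]_p) : 0 <= c ->
  (forall x y, enorm (f x - f y) <= c * enorm (x - y)) -> continuous f.
Proof.
move=> c0 h x; apply: (@enorm_cvg _ _ _ (nbhs x) (nbhs_filter x)) => e e0.
have c1 : 0 < c + 1 by lra.
have := near_enorm x (divr_gt0 e0 c1).
apply: (@filterS _ (nbhs x) (nbhs_filter x)) => y yx.
apply: le_trans (h _ _) _; rewrite ltr_pdivlMr// in yx.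
by have := enorm_ge0 (y - x); nra.
Qed.

(** * Projection onto closed convex sets *)

Section Projection.
Context {R : realType} {m : nat}.
Implicit Types (K A : set 'rV[R]_m) (a p x y z : 'rV[R]_m) (c M : R).

Definition closed_convex K := [/\ K !=set0, closed K &
  forall x y c, K x -> K y -> 0 <= c <= 1 -> K (x + c *: (y - x))].

Definition nearest K a z :=
  K z /\ forall z', K z' -> enorm (a - z) <= enorm (a - z').

Definition cproj K a : 'rV[R]_m := xget 0 (nearest K a).

Lemma nearest_exists K a : K !=set0 -> closed K -> exists z, nearest K a z.
Proof.
move=> [z0 Kz0] clK; pose C := K `&` cball a (enorm (a - z0)).
have C0 : C !=set0 by exists z0; split; rewrite /cball //= enormB.
have cC : compact C.
  by rewrite /C setIC; apply: compact_closedI => //; exact: compact_cball.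
have [z /set_mem[Kz az] zmin] := EVT_min_rV C0 cC
  (continuous_subspaceT (@enormB_continuous _ _ a)).
exists z; split=> // y Ky; rewrite (enormB a z) (enormB a y).
have [ay|/ltW ay] := leP (enorm (y - a)) (enorm (a - z0)).
  by apply: zmin; rewrite inE.
by apply: le_trans ay; exact: az.
Qed.

Lemma cprojP K a : closed_convex K -> nearest K a (cproj K a).
Proof.
move=> [K0 clK _]; apply: xgetPex; exact: nearest_exists.
Qed.

(** Moving from the nearest point z towards y by a fraction c changes the
    squared distance by - 2 c d + c ^ 2 e with d the scalar product and
    e = |y - z| ^ 2, which would be negative for small c if d were positive. *)
Lemma nearest_dotv K a z y : closed_convex K -> nearest K a z -> K y ->
  dotv (a - z) (y - z) <= 0.
Proof.
move=> [_ _ cvx] [Kz zmin] Ky; rewrite leNgt; apply/negP => d0.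
set d := dotv _ _ in d0; pose e := dotv (y - z) (y - z).
have e0 : 0 <= e by exact: dotv_ge0.
(* d / (d + e) is at most 1 and makes 2 c d exceed c ^ 2 e. *)
pose c := d / (d + e).
have de : 0 < d + e by lra.
have c0 : 0 < c by rewrite divr_gt0.
have c1 : c <= 1 by rewrite ler_pdivrMr//; lra.
have cde : c * (d + e) = d by rewrite divfK// gt_eqF.
have := zmin _ (cvx _ _ _ Kz Ky (introT andP (conj (ltW c0) c1))).
rewrite enorm_leE ?enorm_ge0// enorm_sqr opprD addrA.
have -> u v : dotv (u - c *: v) (u - c *: v) =
    dotv u u - 2 * c * dotv u v + c ^+ 2 * dotv v v.
  by rewrite !dotvE (dotvC v u); ring.
rewrite -/d -/e.
move: (dotv (a - z) (a - z)) c c0 c1 cde => s c c0 c1 cde h; nra.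
Qed.

Lemma cproj_dotv K a y : closed_convex K -> K y ->
  dotv (a - cproj K a) (y - cproj K a) <= 0.
Proof. by move=> cK; apply: nearest_dotv cK (cprojP _ cK). Qed.

Lemma cproj_nonexpansive K a b : closed_convex K ->
  enorm (cproj K a - cproj K b) <= enorm (a - b).
Proof.
move=> cK; have [Ka _] := cprojP a cK; have [Kb _] := cprojP b cK.
have := cproj_dotv a cK Kb; have := cproj_dotv b cK Ka.
set u := cproj K a; set v := cproj K b => h1 h2.
have : enorm (u - v) ^+ 2 <= enorm (a - b) * enorm (u - v).
  rewrite enorm_sqr; apply: le_trans (dotv_le_enorm _ _).
  move: h1 h2; rewrite !dotvE (dotvC v u).
  move: (dotv a u) (dotv a v) (dotv b u) (dotv b v) (dotv u u) (dotv u v).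
  by move: (dotv v v) => *; lra.
by have := enorm_ge0 (u - v); have := enorm_ge0 (a - b); nra.
Qed.

Lemma edist_cproj K a : closed_convex K ->
  Defs.edist a K = enorm (a - cproj K a).
Proof.
move=> cK; have [Ka amin] := cprojP a cK.
apply/eqP; rewrite eq_le; apply/andP; split.
  apply: ge_inf; last by exists (cproj K a).
  by exists 0 => _ [z _ <-]; exact: enorm_ge0.
apply: lb_le_inf; first by exists (enorm (a - cproj K a)), (cproj K a).
by move=> _ [z Kz <-]; exact: amin.
Qed.

Lemma min_norm_eltP A : closed_convex A -> nearest A 0 (min_norm_elt A).
Proof.
move=> [A0 clA _]; have [z [Az zmin]] := nearest_exists 0 A0 clA.
have /(xgetPex 0) [] : exists z, [set z | A z /\
    forall z', A z' -> enorm z <= enorm z'] z.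
  by exists z; split=> // y /zmin; rewrite !sub0r !enormN.
move=> Am mmin; split=> // y Ay; rewrite !sub0r !enormN; exact: mmin.
Qed.

Lemma nearest0_uniq A x y : closed_convex A -> nearest A 0 x -> A y ->
  enorm y <= enorm x -> y = x.
Proof.
move=> cA xn Ay; have := nearest_dotv cA xn Ay.
rewrite enorm_leE ?enorm_ge0// enorm_sqr => h1 h2.
apply/eqP; rewrite -subr_eq0; apply/eqP/dotv_eq0.
by move: h1 h2; rewrite sub0r !dotvE (dotvC x y); lra.
Qed.

End Projection.

(** * Faces exposed by a direction *)

Section Support.
Context {R : realType} {m : nat} (K : set 'rV[R]_m) (M : R).
Hypothesis (cK : closed_convex K) (bK : forall z, K z -> enorm z <= M).
Implicit Types (p q x y z : 'rV[R]_m).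

Definition face p := [set z | K z /\ forall y, K y -> dotv p y <= dotv p z].

Lemma compact_closed_convex : compact K.
Proof.
have [_ clK _] := cK.
apply: (subclosed_compact clK (@compact_cball _ _ 0 M)) => z /bK.
by rewrite /cball /= subr0.
Qed.

Lemma dotv_le_support p z : K z -> dotv p z <= support_fun K p.
Proof.
move=> Kz; apply: ub_le_sup; last by exists z.
exists (enorm p * M) => _ [y Ky <-]; apply: le_trans (dotv_le_enorm _ _) _.
by rewrite ler_wpM2l ?enorm_ge0// bK.
Qed.

Lemma support_le p c : (forall z, K z -> dotv p z <= c) -> support_fun K p <= c.
Proof.
move=> h; apply: sup_le_ub; last by move=> _ [z /h ? <-].
by have [[z Kz] _ _] := cK; exists (dotv p z), z.
Qed.

(** Testing a subgradient z against p + v with v = z - proj z, and using that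
    v attains its maximum over K at proj z, forces v = 0, so z lies in K;
    testing it against 0 shows that it attains the support function. *)
Lemma subdiff_support p : subdiff (support_fun K) p = face p.
Proof.
apply/seteqP; split=> z; last first.
  move=> [Kz zmax] q; have := support_le zmax; have := dotv_le_support q Kz.
  by rewrite !dotvE (dotvC z q) (dotvC z p); lra.
move=> zp.
have pz : support_fun K p <= dotv p z.
  have := zp 0; have : support_fun K 0 <= 0.
    by apply: support_le => y _; rewrite dotvC dotv0r.
  by rewrite sub0r !dotvE (dotvC z p); lra.
split; last by move=> y Ky; apply: le_trans pz; exact: dotv_le_support.
set v := z - cproj K z; have := zp (p + v).
have : support_fun K (p + v) <= support_fun K p + dotv v (cproj K z).
  apply: support_le => y Ky; have := dotv_le_support p Ky.
  by have := cproj_dotv z cK Ky; rewrite -/v !dotvE; lra.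
rewrite (addrC p) addrK => h1 h2.
have : v = 0.
  apply: dotv_eq0.
  have -> : dotv v v = dotv z v - dotv v (cproj K z).
    by rewrite (dotvC z) -dotvNr -dotvDr.
  by lra.
by move/eqP; rewrite subr_eq0 => /eqP ->; case: (cprojP z cK).
Qed.

Lemma face_closed_convex p : closed_convex (face p).
Proof.
have [K0 clK cvx] := cK; split.
- have [z /set_mem Kz zmax] := EVT_max_rV K0 compact_closed_convex
    (continuous_subspaceT (@dotv_continuous _ _ p)).
  by exists z; split=> // y Ky; apply: zmax; rewrite inE.
- have -> : face p =
      K `&` \bigcap_(y in K) [set z | dotv (- p) z <= dotv (- p) y].
    apply/seteqP; split=> z [Kz zmax]; split=> // y /zmax /=;
    by rewrite !dotvE lerN2.
  by apply: closedI => //; apply: closed_bigI => y _; exact: closed_dotv_le.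
- move=> x y c [Kx xmax] [Ky ymax] c01; split; first exact: cvx.
  by move=> z Kz; rewrite !dotvE; have := xmax _ Kz; have := ymax _ Kz; nra.
Qed.

Local Notation sel p := (min_norm_elt (subdiff (support_fun K) p)).

Lemma selP p : nearest (face p) 0 (sel p).
Proof. by rewrite subdiff_support; exact/min_norm_eltP/face_closed_convex. Qed.

Lemma sel_le p : enorm (sel p) <= M.
Proof. by have [[/bK]] := selP p. Qed.

(** The projections of k p are the Yosida approximations of the subdifferential
    at p, hence converge to its element z of minimal norm.  Comparing with z
    shows that they have norm at most |z| and that their scalar product with p
    tends to the maximum.  By compactness, points of K of norm at most |z| and
    at distance at least e from z miss that maximum by a fixed gap, since z is
    the only point of the face with norm at most |z|. *)
Lemma cproj_cvg_sel p : cproj K (k%:R *: p) @[k --> \oo] --> sel p.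
Proof.
have [[Kz zmax] zmin] := selP p; set z := sel p.
have zk_face k y : K y -> k%:R * (dotv p y - dotv p (cproj K (k%:R *: p))) <=
    dotv (cproj K (k%:R *: p)) y - enorm (cproj K (k%:R *: p)) ^+ 2.
  move=> Ky; have := cproj_dotv (k%:R *: p) cK Ky.
  by rewrite enorm_sqr !dotvE; lra.
have zk_norm k : enorm (cproj K (k%:R *: p)) <= enorm z.
  set zk := cproj _ _; have := zk_face k _ Kz; rewrite -/z -/zk => h.
  have k0 : 0 <= k%:R :> R by rewrite ler0n.
  have Kzk : K zk by have [] := cprojP (k%:R *: p) cK.
  have := mulr_ge0 k0 (_ : 0 <= dotv p z - dotv p zk).
  rewrite subr_ge0 zmax// => /(_ isT).
  by have := dotv_le_enorm zk z; have := enorm_ge0 zk; have := enorm_ge0 z; nra.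
apply: enorm_cvg => e e0.
pose S := K `&` (cball 0 (enorm z) `&` [set y | e <= enorm (y - z)]).
have cS : compact S.
  rewrite /S setIC; apply: compact_closedI; last by case: cK.
  apply: compact_closedI; first exact: compact_cball.
  apply: (@closed_comp _ _ (fun y => enorm (y - z)) [set t | e <= t]).
    by move=> x _; exact: enormB_continuous.
  exact: closed_ge.
have [S0|/set0P/negP/negPn/eqP S0] := pselect (S !=set0); last first.
  near=> k; rewrite leNgt; apply/negP => ke.
  suff : S (cproj K (k%:R *: p)) by rewrite S0.
  split; first by have [] := cprojP (k%:R *: p) cK.
  by split; [rewrite /cball /= subr0|exact: ltW].
have [y /set_mem [Ky [yz ye]] ymax] := EVT_max_rV S0 cS
    (continuous_subspaceT (@dotv_continuous _ _ p)).
have gap : 0 < dotv p z - dotv p y.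
  rewrite subr_gt0 ltNge; apply/negP => zy.
  have yz' : y = z.
    apply: (nearest0_uniq (face_closed_convex p) (selP p)).
      by split=> // x /zmax; move=> /le_trans; exact.
    by move: yz; rewrite /cball /= subr0.
  by move: ye; rewrite /= yz' subrr enorm0; lra.
near=> k; rewrite leNgt; apply/negP => ke.
have Kzk : K (cproj K (k%:R *: p)) by have [] := cprojP (k%:R *: p) cK.
have := ymax (cproj K (k%:R *: p)).
rewrite inE => /(_ _)/wrap[].
  split=> //; split; [by rewrite /cball /= subr0|exact: ltW].
have := zk_face k _ Kz; set zk := cproj _ _ => h1 h2.
have : (M * M) < k%:R * (dotv p z - dotv p y).
  rewrite -ltr_pdivrMr//; near: k; exact: nbhs_infty_gtr.
have k0 : 0 <= k%:R :> R by rewrite ler0n.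
have := dotv_le_enorm zk z; have := enorm_ge0 zk; have := enorm_ge0 z.
have := bK Kz; have := bK Kzk; rewrite -/z -/zk.
have : 0 <= k%:R * (dotv p y - dotv p zk).
  by apply: mulr_ge0 => //; rewrite subr_ge0.
nra.
Unshelve. all: by end_near. Qed.

End Support.

(** * Truncated sets and Moreau envelopes *)

Section Truncation.
Context {R : realType} {m : nat}.
Implicit Types (K L : set 'rV[R]_m) (a p q x y z : 'rV[R]_m) (c h k M : R).

(** One half of the statement that the Hausdorff distance is at most h. *)
Definition near_set K L h :=
  forall x, K x -> exists2 y, L y & enorm (x - y) <= h.

Definition truncate K a := K `&` cball a (2 * Defs.edist a K).

Lemma cballE y r z : cball y r z = (enorm (y - z) <= r) :> Prop.
Proof. by rewrite /cball /= enormB. Qed.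

Lemma truncateP K a : closed_convex K -> closed_convex (truncate K a).
Proof.
move=> cK; have [K0 clK cvx] := cK; have [Kp _] := cprojP a cK; split.
- exists (cproj K a); split=> //; rewrite cballE edist_cproj//.
  by have := enorm_ge0 (a - cproj K a); lra.
- by apply: closedI => //; exact: closed_cball.
- move=> x y c [Kx ax] [Ky ay] c01; split; first exact: cvx.
  move: ax ay; rewrite /cball /= => ax ay.
  have -> : x + c *: (y - x) - a = (1 - c) *: (x - a) + c *: (y - a).
    by apply/rowP => i; rewrite !mxE; ring.
  apply: le_trans (ler_enormD _ _) _; rewrite !enormZ.
  by rewrite !ger0_norm; nra.
Qed.

Lemma truncate_bounded K a z : truncate K a z ->
  enorm z <= enorm a + 2 * Defs.edist a K.
Proof.
move=> [_]; rewrite /cball /= => az; rewrite -[z](subrK a) addrC.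
by apply: le_trans (ler_enormD _ _) _; rewrite lerD2l.
Qed.

Lemma edist_near K L a h : closed_convex K -> closed_convex L ->
  near_set L K h -> Defs.edist a K <= Defs.edist a L + h.
Proof.
move=> cK cL LK; have [La _] := cprojP a cL; have [y Ky hy] := LK _ La.
rewrite !edist_cproj//; have [_ /(_ _ Ky)] := cprojP a cK.
by have := ler_enorm_add a (cproj L a) y; lra.
Qed.

(** The truncation is Lipschitz for the Hausdorff distance, uniformly in the
    centre a.  A point x of the truncated K has a neighbour y in L, which may
    lie outside the ball of L by 3 h at most; pulling y towards the nearest
    point y0 of L by the fraction c = 3 h / (d + 3 h), with d the distance of
    a to L, brings it back, at a cost c |y0 - y| <= 9 h. *)
Lemma near_truncate K L a h : 0 < h -> closed_convex K -> closed_convex L ->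
  near_set K L h -> near_set L K h ->
  near_set (truncate K a) (truncate L a) (10 * h).
Proof.
move=> h0 cK cL KL LK x [Kx]; rewrite cballE => ax.
have dKL := edist_near a cK cL LK.
have [y Ly xy] := KL _ Kx; have [_ _ cvxL] := cL.
have [Lp _] := cprojP a cL; set y0 := cproj L a in Lp.
have dE : Defs.edist a L = enorm (a - y0) by rewrite edist_cproj.
have d0 : 0 <= Defs.edist a L by rewrite dE enorm_ge0.
set d := Defs.edist a L in dKL dE d0 *.
pose c := 3 * h / (d + 3 * h).
have dh : 0 < d + 3 * h by lra.
have cdh : c * (d + 3 * h) = 3 * h by rewrite divfK// gt_eqF.
have c0 : 0 <= c by rewrite divr_ge0//; lra.
have c1 : c <= 1 by rewrite ler_pdivrMr//; lra.
have ay : enorm (a - y) <= 2 * d + 3 * h.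
  by have := ler_enorm_add a x y; lra.
exists (y + c *: (y0 - y)).
  split; first by apply: cvxL => //; rewrite c0 c1.
  rewrite cballE -/d.
  have -> : a - (y + c *: (y0 - y)) = (1 - c) *: (a - y) + c *: (a - y0).
    by apply/rowP => i; rewrite !mxE; ring.
  apply: le_trans (ler_enormD _ _) _; rewrite !enormZ.
  by rewrite !ger0_norm -?dE; nra.
rewrite opprD addrA; apply: le_trans (ler_enormD _ _) _.
rewrite enormN enormZ ger0_norm//.
have : enorm (y0 - y) <= 3 * d + 3 * h.
  by have := ler_enorm_add y0 a y; rewrite (enormB y0 a) -dE; lra.
by have := enorm_ge0 (y0 - y); nra.
Qed.

(** The Moreau envelope of the support function: the maximum over z in K of
    <p, z> - |z| ^ 2 / 2 k, attained at the projection of k p. *)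
Definition envelope K k p :=
  dotv p (cproj K (k *: p)) - enorm (cproj K (k *: p)) ^+ 2 / (2 * k).

Lemma envelope_max K k p y : closed_convex K -> 0 < k -> K y ->
  dotv p y - enorm y ^+ 2 / (2 * k) <= envelope K k p.
Proof.
move=> cK k0 Ky; rewrite /envelope; set z := cproj _ _.
have [_ /(_ _ Ky)] := cprojP (k *: p) cK; rewrite -/z.
rewrite enorm_leE ?enorm_ge0// enorm_sqr.
rewrite !dotvE (dotvC z p) (dotvC y p) -!enorm_sqr => h.
have k2 : 0 < 2 * k by lra.
rewrite -(ler_pM2r k2) !mulrBl !divfK ?gt_eqF//; nra.
Qed.

(** The envelope is a maximum of affine functions of p, so the maximizer at p
    is a subgradient there. *)
Lemma envelope_subgrad K k p q : closed_convex K -> 0 < k ->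
  envelope K k p + dotv (cproj K (k *: p)) (q - p) <= envelope K k q.
Proof.
move=> cK k0; have [Kz _] := cprojP (k *: p) cK.
have := envelope_max q cK k0 Kz; rewrite {1 2}/envelope; apply: le_trans.
by rewrite (dotvC _ (q - p)) dotvDl dotvNl addrC addrA subrK.
Qed.

Lemma envelope_near K L h k M p : closed_convex K -> closed_convex L ->
  0 < k -> near_set K L h -> (forall z, L z -> enorm z <= M) -> enorm p <= 1 ->
  envelope K k p <= envelope L k p + h + M ^+ 2 / (2 * k).
Proof.
move=> cK cL k0 KL bL p1; have [Kz _] := cprojP (k *: p) cK.
have [y Ly zy] := KL _ Kz; have := envelope_max p cL k0 Ly.
rewrite {2}/envelope; set z := cproj _ _ in Kz zy *.
have : dotv p z <= dotv p y + h.
  have := dotv_le_enorm p (z - y); rewrite !dotvE.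
  by have := enorm_ge0 p; have := enorm_ge0 (z - y); nra.
have k2 : 0 <= (2 * k)^-1 by rewrite invr_ge0; lra.
have : enorm y ^+ 2 / (2 * k) <= M ^+ 2 / (2 * k).
  rewrite ler_wpM2r// lerXn2r ?nnegrE ?enorm_ge0 ?bL//.
  exact: le_trans (enorm_ge0 y) (bL _ Ly).
have : 0 <= enorm z ^+ 2 / (2 * k) by rewrite mulr_ge0// sqr_ge0.
lra.
Qed.

End Truncation.

(** * Integrals of subgradients along a line *)

Section Line.
Context {R : realType}.
Implicit Types (f g : R -> R) (s t a b : R).

(** The difference quotient of f lies between g s and g (s + h). *)
Lemma subgrad_is_derive f g s : continuous g ->
  (forall s t, f s + g s * (t - s) <= f t) -> is_derive s 1 f (g s).
Proof.
move=> cg fg.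
suff cv : h^-1 *: (f (h *: 1 + s) - f s) @[h --> 0^'] --> g s.
  apply: DeriveDef; first by apply/cvg_ex; exists (g s).
  exact/cvg_lim.
apply/cvgrPdist_le => e e0.
have /cvgrPdist_le /(_ e e0) := cg s.
move=> /nbhs_ballP [d d0 hd]; apply/nbhs_ballP; exists d => //= h hh h0.
rewrite /= [_%:A]mulr1; have := fg s (h + s); have := fg (h + s) s.
have : `|g s - g (h + s)| <= e.
  apply: hd; rewrite /ball /= opprD addrCA subrr addr0 -normrN opprK.
  by move: hh; rewrite /ball /= sub0r normrN.
rewrite !ler_norml => /andP[h1 h2] h3 h4.
rewrite -[_ *: _]/(_ * _).
have hV : h^-1 * (f (h + s) - f s) * h = f (h + s) - f s.
  by rewrite mulrAC mulVf// mul1r.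
move: (h^-1 * _) hV => x hV.
case: (ltrgtP h 0) h0 => // hs _; apply/andP; split; nra.
Qed.

Lemma subgrad_integral f g a b : continuous g ->
  (forall s t, f s + g s * (t - s) <= f t) -> a <= b ->
  (\int[lebesgue_measure]_(x in `[a, b]) (g x)%:E = (f b - f a)%:E)%E.
Proof.
move=> cg fg; rewrite le_eqVlt => /predU1P[<-|ab].
  by rewrite set_itv1 integral_set1 subrr.
have df s : derivable f s 1 by case: (subgrad_is_derive s cg fg).
have cf : continuous f.
  by move=> s; apply/differentiable_continuous/derivable1_diffP.
rewrite EFinB; apply: continuous_FTC2 => //.
- exact: continuous_subspaceT.
- split=> //; [exact/cvg_at_right_filter/cf|exact/cvg_at_left_filter/cf].
- by move=> s _; rewrite derive1E; have [] := subgrad_is_derive s cg fg.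
Qed.

End Line.

(** * Lebesgue measure on tuples *)

Section TupleMeasure.
Context {R : realType}.
Local Notation RT := (measurableTypeR R).
Local Notation mu m := (@lebesgue_tuple R m).

Lemma rV_of_tupleE m (t : m.-tuple RT) i : rV_of_tuple t 0 i = tnth t i.
Proof. by rewrite mxE. Qed.

Lemma floor_div_dist (x N e : R) : 0 < N -> N^-1 < e ->
  `|x - (Num.floor (x * N))%:~R / N| <= e.
Proof.
move=> N0 Ne.
have fl1 : (Num.floor (x * N))%:~R / N <= x by rewrite ler_pdivrMr// ge_floor.
have fl2 : x < ((Num.floor (x * N))%:~R + 1) / N.
  by rewrite ltr_pdivlMr// -[1]/(1%:~R) -intrD floorD1_gt.
by rewrite mulrDl mul1r in fl2; rewrite ger0_norm; lra.
Qed.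

(** The product sigma-algebra gives measurability of the coordinates, hence of
    boxes; f is the limit of its values at the lower corners of the cells of the
    cubic grid of mesh 1 / (k + 1), and these approximations are constant on
    each of countably many boxes. *)
Lemma measurable_continuous m (f : 'rV[R]_m -> R) : continuous f ->
  measurable_fun setT (f \o @rV_of_tuple R m).
Proof.
move=> cf.
pose grid k (v : {ffun 'I_m -> int}) : 'rV[R]_m := \row_i ((v i)%:~R / k.+1%:R).
pose cell k (t : m.-tuple RT) : {ffun 'I_m -> int} :=
  [ffun i => Num.floor (tnth t i * k.+1%:R)].
apply: (@measurable_fun_cvg _ _ _ _ (fun k t => f (grid k (cell k t)))).
  move=> k _ A mA; rewrite setTI.
  have -> : (fun t => f (grid k (cell k t))) @^-1` A =
      \bigcup_v (if pselect (A (f (grid k v))) then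
        \bigcap_(i in [set: 'I_m])
           ((fun t : m.-tuple RT => tnth t i * k.+1%:R) @^-1`
             `[(v i)%:~R, (v i + 1)%:~R[) else set0).
    apply/seteqP; split=> [t At|t [v _]].
      exists (cell k t) => //; case: pselect => // _ i _ /=.
      by rewrite in_itv /= ffunE ge_floor floorD1_gt.
    case: pselect => // Av vt; rewrite /preimage /=.
    suff -> : cell k t = v by [].
    apply/ffunP => i; rewrite ffunE; apply: floor_def.
    by have := vt i I; rewrite /= in_itv.
  apply: countable_bigcupT_measurable; first exact: countableP.
  move=> v; case: pselect => [Av|nAv] /=; last exact: measurable0.
  apply: fin_bigcap_measurable => // i _; rewrite -[X in measurable X]setTI.
  have mh :
      measurable_fun setT (fun t : m.-tuple RT => tnth t i * k.+1%:R : RT).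
    by apply: measurable_funM => //; exact: measurable_tnth.
  by apply: mh => //; exact: measurable_itv.
move=> t _; apply: (@cvg_comp _ _ _ (fun k => grid k (cell k t)) f \oo
  (nbhs (rV_of_tuple t))); last exact: cf.
apply/cvgrPdist_le => e e0; near=> k.
rewrite /Num.Def.normr /= mx_normrE.
apply: bigmax_le => [|[i j] _ /=]; first exact: ltW.
rewrite ord1 !mxE ffunE.
apply: floor_div_dist => //.
near: k; exact: near_infty_natSinv_lt (PosNum e0).
Unshelve. all: by end_near. Qed.

Lemma measurable_fun_coord m p (f : 'rV[R]_m -> 'rV[R]_p) i : continuous f ->
  measurable_fun setT (fun t => f (@rV_of_tuple R m t) 0 i).
Proof.
move=> cf; apply: (@measurable_continuous m (fun x => f x 0 i)) => x.
exact: (@continuous_comp _ _ _ f (fun u => u 0 i) x (cf x)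
  (@coord_continuous R 1 p 0 i _)).
Qed.

Definition tball m : set (m.-tuple RT) := @rV_of_tuple R m @^-1` cball 0 1.

(** The slicing argument runs by induction on the dimension, and unlike balls
    cubes are products. *)
Definition cube m : set (m.-tuple RT) := [set t | forall i, `|tnth t i| <= 1].

Arguments tball m : clear implicits.
Arguments cube m : clear implicits.

Lemma measurable_tball m : measurable (tball m).
Proof.
have := @measurable_continuous m _ (@enormB_continuous _ _ 0).
move=> /(_ measurableT `]-oo, 1]%classic (measurable_itv _)); rewrite setTI.
congr (measurable _); apply/seteqP; split=> t;
by rewrite /tball /cball /= in_itv.
Qed.

Lemma tball_cube m : tball m `<=` cube m.
Proof.
move=> t; rewrite /tball /cball /= subr0 => t1 i; rewrite -rV_of_tupleE.
exact: le_trans (norm_coord_le_enorm _ _) t1.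
Qed.

Lemma measurable_cube m : measurable (cube m).
Proof.
have -> : cube m =
    \bigcap_(i in [set: 'I_m]) ((fun t => tnth t i) @^-1` `[-1, 1]).
  apply/seteqP; split=> t ti i; have := ti i;
  by rewrite /= in_itv /= ler_norml //; apply.
apply: fin_bigcap_measurable => // i _; rewrite -[X in measurable X]setTI.
by apply: measurable_tnth => //; exact: measurable_itv.
Qed.

Lemma cube_cons m : cons_pair (m:=m) @^-1` cube m.+1 = `[-1, 1] `*` cube m.
Proof.
apply/seteqP; split=> -[s t] /=.
  move=> st; split; first by have := st ord0; rewrite in_itv /= ler_norml.
  by move=> i; have := st (lift ord0 i); rewrite tnthS.
move=> [s1 t1] i; case: (unliftP ord0 i) => [j ->|->]; first by rewrite tnthS.
by rewrite tnth0 ler_norml; rewrite in_itv in s1.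
Qed.

Lemma cube_volume m : mu m (cube m) = (2 ^+ m)%:E.
Proof.
elim: m => [|m IH].
  by rewrite /= diracE mem_set// => -[].
rewrite /= /cons_measure /pushforward cube_cons.
rewrite product_measure1E//; last exact: measurable_cube.
have I2 : lebesgue_measure (`[(-1)%R, 1%R]%classic : set R) = 2%:E.
  by rewrite lebesgue_measure_itv /= lte_fin ifT; [rewrite -EFinB opprK|lra].
by rewrite IH exprS EFinM; congr (_ * _)%E; exact: I2.
Qed.

Lemma tball_volume m : (mu m (tball m) < +oo)%E.
Proof.
apply: (@le_lt_trans _ _ (mu m (cube m))); last by rewrite cube_volume ltry.
apply: le_measure; rewrite ?inE; last exact: tball_cube.
- exact: measurable_tball.
- exact: measurable_cube.
Qed.

End TupleMeasure.
Arguments tball {R} m _.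
Arguments cube {R} m _.

(** * Bounded functions on a set of finite measure *)

Section Domination.
Local Open Scope ereal_scope.
Context d (T : measurableType d) (R : realType).
Variable (nu : {measure set T -> \bar R}) (A : set T) (mA : measurable A).

Lemma integral_scaled_indic (C : R) : (0 <= C)%R ->
  \int[nu]_x (C * \1_A x)%:E = C%:E * nu A.
Proof.
move=> C0; under eq_integral do rewrite EFinM.
rewrite ge0_integralZl_EFin//; first by rewrite integral_indic// setIT.
exact/measurable_EFinP.
Qed.

Lemma integrable_le_indic (g : T -> R) (C : R) : nu A < +oo ->
  measurable_fun setT g -> (forall x, `|g x| <= C * \1_A x)%R ->
  nu.-integrable setT (EFin \o g).
Proof.
move=> nuA mg gC.
apply: (@le_integrable _ _ _ _ _ _ _ (fun x => C%:E * (\1_A x)%:E)) => //.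
- exact/measurable_EFinP.
- move=> x _; rewrite -EFinM !abse_EFin lee_fin (le_trans (gC x))//.
  exact: ler_norm.
- apply: integrableZl => //; apply/integrableP; split.
    exact/measurable_EFinP.
  under eq_integral do rewrite gee0_abs ?lee_fin//.
  by rewrite integral_indic// setIT.
Qed.

Lemma abse_integral_le_indic (F : T -> \bar R) (C : R) : (0 <= C)%R ->
  measurable_fun setT F -> (forall x, `|F x| <= (C * \1_A x)%:E) ->
  `|\int[nu]_x F x| <= C%:E * nu A.
Proof.
move=> C0 mF FC; rewrite -integral_scaled_indic//.
apply: le_trans (le_abse_integral _ _ _) _ => //.
apply: ge0_le_integral => //; first exact: measurableT_comp.
- by apply/measurable_EFinP; apply: measurable_funM.
Qed.

End Domination.

(** * Slicing an integral along one coordinate *)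

Section Slices.
Context {R : realType}.
Local Notation RT := (measurableTypeR R).
Local Notation mu m := (@lebesgue_tuple R m).
Local Notation lam := (@lebesgue_measure R).

Definition tuple_update m (t : m.-tuple RT) (i : 'I_m) (s : R) : m.-tuple RT :=
  [tuple if j == i then s else tnth t j | j < m].

Lemma tuple_update_cons0 m (t : m.-tuple RT) (r s : R) :
  tuple_update (cons_pair (r, t)) ord0 s = cons_pair (s, t).
Proof.
apply: eq_from_tnth => j; rewrite tnth_mktuple.
by case: (unliftP ord0 j) => [k ->|->]; rewrite ?eqxx// !tnthS.
Qed.

Lemma tuple_update_consS m (t : m.-tuple RT) (r s : R) i :
  tuple_update (cons_pair (r, t)) (lift ord0 i) s =
  cons_pair (r, tuple_update t i s).
Proof.
apply: eq_from_tnth => j; rewrite tnth_mktuple.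
case: (unliftP ord0 j) => [k ->|->]; last by rewrite !tnth0.
by rewrite !tnthS tnth_mktuple (inj_eq lift_inj).
Qed.

Definition cube_dominated m (M : R) (g : m.-tuple RT -> R) :=
  measurable_fun setT g /\ forall t, `|g t| <= M * \1_(cube m) t.

Lemma cube_indic_cons m (p : RT * m.-tuple RT) :
  \1_(cube m.+1) (cons_pair p) =
  \1_(`[(-1)%R, 1%R]%classic : set R) p.1 * \1_(cube m) p.2 :> R.
Proof.
have := @cube_cons R m; move/seteqP => [/(_ p) h1 /(_ p) h2].
rewrite !indicE -natrM mulnb; congr (_%:R); congr nat_of_bool.
by apply/idP/andP; rewrite !inE; [move/h1|move=> ?; exact: h2].
Qed.

Section Cons.
Context m (M : R) (g : m.+1.-tuple RT -> R).
Hypothesis (M0 : 0 <= M) (gM : cube_dominated M g).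
Local Open Scope ereal_scope.

Let h (p : RT * m.-tuple RT) := (g (cons_pair p))%:E.

Let h_int : (lam \x mu m).-integrable setT h.
Proof.
have := @integrable_le_indic _ _ _ (lam \x mu m)
  (`[(-1)%R, 1%R]%classic `*` cube m) _ (g \o @cons_pair R m) M.
apply.
- apply: measurableX; [exact: measurable_itv|exact: measurable_cube].
- rewrite -cube_cons -[X in X < _]/(mu m.+1 (cube m.+1)) cube_volume ltry //.
- by apply: measurableT_comp; [case: gM|exact: measurable_cons_pair].
- by move=> p; have [_ /(_ (cons_pair p))] := gM; rewrite /= -cube_cons.
Qed.

Lemma integral_cons : \int[mu m.+1]_t (g t)%:E = \int[lam \x mu m]_p h p.
Proof.
rewrite [LHS](_ : _ =
  \int[pushforward (lam \x mu m) (@cons_pair R m)]_t (g t)%:E)//.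
rewrite integral_pushforward ?preimage_setT//.
  exact: measurable_cons_pair.
  by apply/measurable_EFinP; case: gM.
Qed.

Lemma cube_dominated_tail (s : RT) :
  cube_dominated M (fun t : m.-tuple RT => g (cons_pair (s, t))).
Proof.
split.
  apply: (@measurable_fun_pair2 _ _ _ _ _ _ (g \o @cons_pair R m)).
  by apply: measurableT_comp; [case: gM|exact: measurable_cons_pair].
move=> t; have [_ /(_ (cons_pair (s, t)))] := gM.
rewrite cube_indic_cons => /le_trans; apply; rewrite ler_wpM2l//=.
by rewrite indicE; case: (_ \in _); rewrite ?mul1r ?mul0r.
Qed.

(** Fubini with the first coordinate integrated first. *)
Lemma integral_cons_head C : (0 <= C)%R ->
  (forall t, `|\int[lam]_s h (s, t)| <= C%:E) ->
  `|\int[mu m.+1]_t (g t)%:E| <= (C * 2 ^+ m)%:E.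
Proof.
move=> C0 hC; rewrite integral_cons -(integral21_prod_meas1 h_int).
rewrite EFinM -cube_volume.
apply: abse_integral_le_indic => //; first exact: measurable_cube.
  exact: (measurable_fubini_G h_int).
move=> t; rewrite indicE; have [tc|tc] := boolP (t \in cube m).
  by rewrite mulr1; exact: hC.
rewrite mulr0 /fubini_G integral0_eq ?abse0// => s _; congr EFin.
have [_ /(_ (cons_pair (s, t)))] := gM.
rewrite cube_indic_cons [X in (M * (_ * X))%R]indicE (negbTE tc) !mulr0.
by rewrite normr_le0 => /eqP.
Qed.

(** Fubini with the first coordinate integrated last; 2 is the length of its
    range. *)
Lemma integral_cons_tail C : (0 <= C)%R ->
  (forall s, `|\int[mu m]_t h (s, t)| <= C%:E) ->
  `|\int[mu m.+1]_t (g t)%:E| <= (C * 2)%:E.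
Proof.
move=> C0 hC; rewrite integral_cons -(integral12_prod_meas1 h_int) EFinM.
have -> : 2%:E = lam (`[(-1)%R, 1%R]%classic : set R).
  by rewrite lebesgue_measure_itv /= lte_fin ifT; [rewrite -EFinB opprK|lra].
have := @abse_integral_le_indic _ _ R lam (`[(-1)%R, 1%R]%classic) _
  (fubini_F (mu m) h) C C0.
apply; first exact: measurable_itv.
  exact: (measurable_fubini_F h_int).
move=> s; rewrite indicE.
have [sc|sc] := boolP (s \in (`[(-1)%R, 1%R]%classic : set R)).
  by rewrite mulr1; exact: hC.
rewrite mulr0 /fubini_F integral0_eq ?abse0// => t _; congr EFin.
have [_ /(_ (cons_pair (s, t)))] := gM.
rewrite cube_indic_cons [X in (M * (X * _))%R]indicE (negbTE sc) mul0r mulr0.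
by rewrite normr_le0 => /eqP.
Qed.

End Cons.

(** The measure is built by adding coordinates at the head, so the coordinate i
    is reached by integrating the preceding ones last; each of the other
    coordinates costs a factor 2, the side of the cube, and the exponent m
    rather than m - 1 is a convenient upper bound. *)
Lemma slice_bound m (i : 'I_m) (g : m.-tuple RT -> R) (M C : R) :
  0 <= M -> 0 <= C -> cube_dominated M g ->
  (forall t, `|\int[lam]_s (g (tuple_update t i s))%:E| <= C%:E)%E ->
  (`|\int[mu m]_t (g t)%:E| <= (C * 2 ^+ m)%:E)%E.
Proof.
move=> M0 C0; elim: m i g => [[]//|m IH] i g gM hC.
case: (unliftP ord0 i) => [j ij|i0].
  rewrite exprSr mulrA.
  apply: (integral_cons_tail gM); first by rewrite mulr_ge0// exprn_ge0.
  move=> s; apply: (IH j); first exact: cube_dominated_tail.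
  move=> t; have := hC (cons_pair (s, t)); rewrite ij.
  by under eq_integral do rewrite tuple_update_consS.
apply: le_trans (integral_cons_head gM C0 _) _.
  move=> t; have := hC (cons_pair (0, t)); rewrite i0.
  by under eq_integral do rewrite tuple_update_cons0.
by rewrite lee_fin ler_wpM2l// ler_weXn2l// ler1n.
Qed.

End Slices.

(** * Integrals of gradients over the unit ball *)

Section BallGradient.
Context {R : realType} {m : nat}.
Local Notation RT := (measurableTypeR R).
Local Notation mu := (@lebesgue_tuple R m).
Local Notation lam := (@lebesgue_measure R).
Variables (f1 f2 : 'rV[R]_m -> R) (G1 G2 : 'rV[R]_m -> 'rV[R]_m) (M C : R).
Hypotheses (cG1 : continuous G1) (cG2 : continuous G2).
Hypotheses (bG1 : forall p : 'rV[R]_m, enorm (G1 p) <= M)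
           (bG2 : forall p, enorm (G2 p) <= M).
Hypotheses (fG1 : forall p q, f1 p + dotv (G1 p) (q - p) <= f1 q)
           (fG2 : forall p q, f2 p + dotv (G2 p) (q - p) <= f2 q).
Hypothesis f12 : forall p, enorm p <= 1 -> `|f1 p - f2 p| <= C.
Variable i : 'I_m.

Let e : 'rV[R]_m := delta_mx 0 i.

Lemma dotv_delta (u : 'rV[R]_m) : dotv u (delta_mx 0 i) = u 0 i.
Proof.
rewrite /dotv (bigD1 i)//= big1 ?mxE ?eqxx ?mulr1 ?addr0// => j ji.
by rewrite mxE (negbTE ji) andbF mulr0.
Qed.

Lemma rV_of_tuple_update t s :
  rV_of_tuple (tuple_update t i s) =
  rV_of_tuple (tuple_update t i 0) + s *: e.
Proof.
apply/rowP => j; rewrite !mxE !tnth_mktuple eqxx /=.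
by case: eqP => _; rewrite ?mulr1 ?mulr0 ?add0r ?addr0.
Qed.

Lemma line_continuous (p0 : 'rV[R]_m) : continuous (fun s : R => p0 + s *: e).
Proof.
move=> s; apply: cvgD; first exact: cvg_cst.
by apply: cvgZr_tmp; exact: cvg_id.
Qed.

Lemma line_subgrad (f : 'rV[R]_m -> R) (G : 'rV[R]_m -> 'rV[R]_m) p0 (s t : R) :
  (forall p q, f p + dotv (G p) (q - p) <= f q) ->
  f (p0 + s *: e) + G (p0 + s *: e) 0 i * (t - s) <= f (p0 + t *: e).
Proof.
move=> /(_ (p0 + s *: e) (p0 + t *: e)).
have -> : p0 + t *: e - (p0 + s *: e) = (t - s) *: e.
  by apply/rowP => j; rewrite !mxE; ring.
by rewrite dotvZr dotv_delta mulrC.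
Qed.

Lemma line_coord_continuous (G : 'rV[R]_m -> 'rV[R]_m) p0 : continuous G ->
  continuous (fun s : R => G (p0 + s *: e) 0 i).
Proof.
move=> cG s.
have h1 := @continuous_comp _ _ _ _ G s (@line_continuous p0 s) (cG _).
exact: (@continuous_comp _ _ _ _ (fun u : 'rV[R]_m => u 0 i) s h1
  (@coord_continuous R 1 m 0 i _)).
Qed.

Let g t := G1 (rV_of_tuple t) 0 i - G2 (rV_of_tuple t) 0 i.

Lemma segment_integral p0 a : 0 <= a ->
  enorm (p0 + a *: e) <= 1 -> enorm (p0 + (- a) *: e) <= 1 ->
  (`|\int[lam]_(s in `[(- a)%R, a])
     (G1 (p0 + s *: e)%R 0 i - G2 (p0 + s *: e)%R 0 i)%:E| <= (2 * C)%:E)%E.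
Proof.
move=> a0 pa pNa.
have int (G : 'rV[R]_m -> 'rV[R]_m) : continuous G ->
    lam.-integrable `[(- a)%R, a]
      (EFin \o (fun s : R => G (p0 + s *: e)%R 0 i)).
  move=> cG; apply: continuous_compact_integrable; first exact: segment_compact.
  by apply: continuous_subspaceT => s; exact: line_coord_continuous.
rewrite integralB_EFin//; [|exact: int|exact: int].
have aa : - a <= a by lra.
rewrite (@subgrad_integral _ (fun s => f1 (p0 + s *: e)) _ _ _
  (line_coord_continuous cG1) _ aa); last by move=> s t; exact: line_subgrad.
rewrite (@subgrad_integral _ (fun s => f2 (p0 + s *: e)) _ _ _
  (line_coord_continuous cG2) _ aa); last by move=> s t; exact: line_subgrad.
rewrite -EFinB lee_fin; have := f12 pa; have := f12 pNa.
by rewrite !ler_norml => /andP[? ?] /andP[? ?]; apply/andP; split; lra.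
Qed.

(** In place of the divergence theorem: along each chord of the ball parallel
    to the i-th axis, the integral of the i-th partial derivative of f1 - f2 is
    the difference of its values at the two end points, hence at most 2 C. *)
Lemma ball_gradient : 0 <= C ->
  (`|\int[mu]_(t in tball m) (g t)%:E| <= (2 * C * 2 ^+ m)%:E)%E.
Proof.
move=> C0; rewrite integral_mkcond restrict_EFin.
have M0 : 0 <= M by exact: le_trans (enorm_ge0 (G1 0)) (bG1 0).
have mg : measurable_fun setT g.
  by apply: measurable_funB; exact: measurable_fun_coord.
have mtb := @measurable_tball R m.
apply: (@slice_bound _ _ i _ (2 * M)); [by lra|by lra| |].
  split; first by apply/(measurable_restrictT _ mtb); exact: measurable_funTS.
  move=> t; rewrite patchE indicE.
  have [tb|tb] := boolP (t \in tball m); last by rewrite normr0 mulr_ge0//; lra.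
  have -> : t \in cube m by move: tb; rewrite !inE; exact: tball_cube.
  have := le_trans (norm_coord_le_enorm _ i) (bG1 (rV_of_tuple t)).
  have := le_trans (norm_coord_le_enorm _ i) (bG2 (rV_of_tuple t)).
  rewrite /g mulr1 !ler_norml => /andP[? ?] /andP[? ?]; apply/andP; split; lra.
move=> t; set p0 := rV_of_tuple (tuple_update t i 0).
have p0e : dotv p0 e = 0 by rewrite dotv_delta mxE tnth_mktuple eqxx.
have ee : dotv e e = 1 by rewrite dotv_delta mxE !eqxx.
have ball_line s :
    (tuple_update t i s \in tball m) = (dotv p0 p0 + s ^+ 2 <= 1).
  apply/idP/idP; rewrite inE /tball /cball /= subr0 rV_of_tuple_update -/p0;
  by rewrite enorm_leE// expr1n !dotvE (dotvC e) p0e ee; lra.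
have [p1|p1] := ltP 1 (dotv p0 p0).
  rewrite integral0_eq ?abse0 ?lee_fin; first by lra.
  move=> s _; congr EFin; rewrite patchE ball_line ifF//.
  by apply/negbTE; rewrite -ltNge; have := sqr_ge0 s; lra.
(* The chord through p0, which is orthogonal to the axis, is |s| <= a. *)
pose a := Num.sqrt (1 - dotv p0 p0).
have a0 : 0 <= a by exact: sqrtr_ge0.
have a2 : a ^+ 2 = 1 - dotv p0 p0 by rewrite sqr_sqrtr// subr_ge0.
have in_ball s : s ^+ 2 = a ^+ 2 -> enorm (p0 + s *: e) <= 1.
  move=> sa; have /idP := ball_line s; rewrite sa a2.
  rewrite subrKC lexx => /set_mem.
  by rewrite /tball /cball /= subr0 rV_of_tuple_update.
have := segment_integral a0 (in_ball a erefl) (in_ball (- a) (sqrrN a)).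
rewrite integral_mkcond; congr (`|_| <= _)%E; apply: eq_integral => s _.
rewrite !patchE ball_line /g rV_of_tuple_update -/p0.
have -> : (s \in `[(- a)%R, a]%classic) = (dotv p0 p0 + s ^+ 2 <= 1).
  rewrite mem_setE in_itv /= -ler_norml -(@ler_sqr _ `|s|) ?nnegrE//.
  by rewrite real_normK ?num_real// a2 lerBrDl.
by case: ifP.
Qed.

End BallGradient.

(** * Lipschitz continuity of the Steiner point *)

Section SteinerPoint.
Context {R : realType} {m : nat}.
Local Notation RT := (measurableTypeR R).
Local Notation mu := (@lebesgue_tuple R m).
Implicit Types (K L : set 'rV[R]_m) (M h : R).

Local Notation sel K t :=
  (min_norm_elt (subdiff (support_fun K) (rV_of_tuple t))).

Lemma scaled_cproj_continuous K (k : R) : closed_convex K ->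
  continuous (fun p : 'rV[R]_m => cproj K (k *: p)).
Proof.
move=> cK; apply: (@enorm_lipschitz_continuous _ _ _ `|k|) => // x y.
by apply: le_trans (cproj_nonexpansive _ _ cK) _; rewrite -scalerBr enormZ.
Qed.

Lemma cproj_sel_cvg K M t i :
  closed_convex K -> (forall z, K z -> enorm z <= M) ->
  cproj K (k%:R *: rV_of_tuple t) 0 i @[k --> \oo] --> sel K t 0 i.
Proof.
move=> cK bK; apply: (@cvg_comp _ _ _ _ (fun u : 'rV[R]_m => u 0 i)).
  exact: (cproj_cvg_sel cK bK).
exact: coord_continuous.
Qed.

Lemma measurable_sel K M i :
  closed_convex K -> (forall z, K z -> enorm z <= M) ->
  measurable_fun setT (fun t : m.-tuple RT => sel K t 0 i).
Proof.
move=> cK bK.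
apply: (@measurable_fun_cvg _ _ _ _
  (fun k t => cproj K (k%:R *: rV_of_tuple t) 0 i)).
  move=> k; apply: (@measurable_fun_coord _ _ _ (fun p => cproj K (k%:R *: p))).
  exact: scaled_cproj_continuous.
by move=> t _; exact: cproj_sel_cvg cK bK.
Qed.

Lemma integrable_tball (g : m.-tuple RT -> R) M : measurable_fun setT g ->
  (forall t, `|g t| <= M) -> mu.-integrable (tball m) (EFin \o g).
Proof.
move=> mg gM; apply: measurable_bounded_integrable.
- exact: measurable_tball.
- exact: tball_volume.
- exact: measurable_funTS.
- exists M; split; first exact: num_real.
  by move=> x Mx t _; exact: le_trans (gM t) (ltW Mx).
Qed.

Lemma integrable_sel K M i :
  closed_convex K -> (forall z, K z -> enorm z <= M) ->
  mu.-integrable (tball m) (EFin \o (fun t => sel K t 0 i)).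
Proof.
move=> cK bK; apply: (@integrable_tball _ M); first exact: measurable_sel cK bK.
by move=> t; apply: le_trans (norm_coord_le_enorm _ _) (sel_le cK bK _).
Qed.

(** The bound does not involve the size M of the sets.  The integrands are
    limits of differences of gradients of envelopes, and these envelopes differ
    on the unit ball by at most h + M ^ 2 / 2 k, where k is free. *)
Lemma sel_integral_dist K L M h i :
  closed_convex K -> closed_convex L ->
  (forall z, K z -> enorm z <= M) -> (forall z, L z -> enorm z <= M) ->
  0 <= h -> near_set K L h -> near_set L K h ->
  (`|\int[mu]_(t in tball m) (sel K t 0 i - sel L t 0 i)%:E| <=
    (2 * h * 2 ^+ m)%:E)%E.
Proof.
move=> cK cL bK bL h0 KL LK.
have mtb := @measurable_tball R m.
have bproj (A : set 'rV[R]_m) p :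
    closed_convex A -> (forall z, A z -> enorm z <= M) -> `|cproj A p 0 i| <= M.
  move=> cA bA; apply: le_trans (norm_coord_le_enorm _ _) _.
  by apply: bA; case: (cprojP p cA).
pose d k t :=
  cproj K (k *: rV_of_tuple t) 0 i - cproj L (k *: rV_of_tuple t) 0 i.
have bd k (t : m.-tuple RT) : `|d k t| <= 2 * M.
  have := bproj _ (k *: rV_of_tuple t) cK bK.
  have := bproj _ (k *: rV_of_tuple t) cL bL.
  rewrite /d !ler_norml => /andP[? ?] /andP[? ?].
  by apply/andP; split; lra.
have md k : measurable_fun setT (d k).
  apply: measurable_funB.
    apply: (@measurable_fun_coord _ _ _ (fun p => cproj K (k *: p))).
    exact: scaled_cproj_continuous.
  apply: (@measurable_fun_coord _ _ _ (fun p => cproj L (k *: p))).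
  exact: scaled_cproj_continuous.
have cvd : (\int[mu]_(t in tball m) (d k%:R t)%:E)%E @[k --> \oo] -->
    (\int[mu]_(t in tball m) (sel K t 0 i - sel L t 0 i)%:E)%E.
  have := @dominated_convergence _ _ R mu (tball m) mtb
    (fun k t => (d k%:R t)%:E) (fun t => (sel K t 0 i - sel L t 0 i)%:E)
    (fun=> (2 * M)%:E).
  case=> // [k||||].
  - by apply/measurable_EFinP; exact: measurable_funTS.
  - apply/measurable_EFinP; apply: measurable_funTS.
    by apply: measurable_funB;
      [exact: measurable_sel cK bK|exact: measurable_sel cL bL].
  - apply: aeW => t _; apply: cvg_EFin; first exact: nearW.
    by apply: cvgB; [exact: cproj_sel_cvg cK bK|exact: cproj_sel_cvg cL bL].
  - exact: (@integrable_tball (cst (2 * M)) `|2 * M|).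
  - by apply: aeW => t k _; rewrite lee_fin.
apply/lee_addgt0Pr => e e0.
apply: (cvge_le _ (cvg_abse cvd)).
near=> k.
have k0 : 0 < k%:R :> R by near: k; exact: nbhs_infty_gtr.
set b := h + M ^+ 2 / (2 * k%:R).
have b0 : 0 <= b by rewrite addr_ge0// divr_ge0 ?sqr_ge0//; lra.
apply: le_trans (@ball_gradient _ _ (envelope K k%:R) (envelope L k%:R)
  (fun p => cproj K (k%:R *: p)) (fun p => cproj L (k%:R *: p)) M b
  (scaled_cproj_continuous cK) (scaled_cproj_continuous cL) _ _ _ _ _ i b0) _.
- by move=> p; apply: bK; case: (cprojP (k%:R *: p) cK).
- by move=> p; apply: bL; case: (cprojP (k%:R *: p) cL).
- by move=> p q; exact: envelope_subgrad.
- by move=> p q; exact: envelope_subgrad.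
- move=> p p1; rewrite ler_norml.
  have := envelope_near cK cL k0 KL bL p1.
  have := envelope_near cL cK k0 LK bK p1.
  by rewrite /b => ? ?; apply/andP; split; lra.
rewrite -EFinD lee_fin /b.
suff : 2 * (M ^+ 2 / (2 * k%:R)) * 2 ^+ m <= e by lra.
have -> : 2 * (M ^+ 2 / (2 * k%:R)) * 2 ^+ m = (M ^+ 2 * 2 ^+ m) / k%:R.
  by field; rewrite gt_eqF.
rewrite ler_pdivrMr// (mulrC e) -ler_pdivrMr//; apply: ltW.
near: k; exact: nbhs_infty_gtr.
Unshelve. all: by end_near. Qed.

Lemma steiner_coord K i : steiner K 0 i =
  (fine (mu (tball m)))^-1 * \int[mu]_(t in tball m) sel K t 0 i.
Proof. by rewrite mxE. Qed.

Lemma steiner_coord_lipschitz K L M h i :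
  closed_convex K -> closed_convex L ->
  (forall z, K z -> enorm z <= M) -> (forall z, L z -> enorm z <= M) ->
  0 <= h -> near_set K L h -> near_set L K h ->
  `|steiner K 0 i - steiner L 0 i| <=
    (fine (mu (tball m)))^-1 * (2 * h * 2 ^+ m).
Proof.
move=> cK cL bK bL h0 KL LK; rewrite !steiner_coord -mulrBr.
have V0 : 0 <= (fine (mu (tball m)))^-1 by rewrite invr_ge0 fine_ge0.
rewrite normrM (ger0_norm V0) ler_wpM2l//.
rewrite -RintegralB; [|exact: measurable_tball|exact: integrable_sel cK bK|
  exact: integrable_sel cL bL].
rewrite -lee_fin EFin_normr_Rintegral; last 2 first.
- exact: measurable_tball.
- by apply: (@integrableB _ _ _ _ _ _ (EFin \o _) (EFin \o _));
    [exact: measurable_tball|exact: integrable_sel cK bK|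
     exact: integrable_sel cL bL].
exact: sel_integral_dist bK bL h0 KL LK.
Qed.

Lemma Rintegral_dotv u (g : m.-tuple RT -> 'rV[R]_m) :
  (forall i, mu.-integrable (tball m) (EFin \o (fun t => g t 0 i))) ->
  mu.-integrable (tball m) (EFin \o (fun t => dotv u (g t))) /\
  \int[mu]_(t in tball m) dotv u (g t) =
    \sum_i u 0 i * \int[mu]_(t in tball m) g t 0 i.
Proof.
move=> ig; have mtb := @measurable_tball R m; rewrite /dotv.
elim: (index_enum _) => [|i s [is0 IH]].
  rewrite big_nil; split.
    under [EFin \o _]eq_fun do rewrite big_nil.
    exact: integrable0.
  under eq_Rintegral do rewrite big_nil.
  by rewrite Rintegral_cst// mul0r.
have iu : mu.-integrable (tball m) (EFin \o (fun t => u 0 i * g t 0 i)).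
  by apply: (@integrableZl _ _ _ _ _ _ _ (EFin \o _)).
split.
  under [EFin \o _]eq_fun do rewrite big_cons EFinD.
  exact: (integrableD mtb iu is0).
under eq_Rintegral do rewrite big_cons.
by rewrite RintegralD// RintegralZl// IH big_cons.
Qed.

(** The Steiner point averages points of K over the unit ball, of volume V; for
    nonnegative b the inequality V^-1 (b V) <= b also covers V = 0. *)
Lemma dotv_steiner_le K M u b : closed_convex K ->
  (forall z, K z -> enorm z <= M) -> 0 <= b ->
  (forall z, K z -> dotv u z <= b) -> dotv u (steiner K) <= b.
Proof.
move=> cK bK b0 ub; have mtb := @measurable_tball R m.
have [iu iuE] := Rintegral_dotv u (fun i => integrable_sel i cK bK).
set V := fine (mu (tball m)).
have V0 : 0 <= V by rewrite fine_ge0.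
have -> : dotv u (steiner K) = V^-1 * \int[mu]_(t in tball m) dotv u (sel K t).
  rewrite iuE mulr_sumr; apply: eq_bigr => i _.
  by rewrite steiner_coord mulrCA.
apply: (@le_trans _ _ (V^-1 * (b * V))).
  rewrite ler_wpM2l ?invr_ge0// -(Rintegral_cst mu mtb).
  apply: le_Rintegral => //.
    exact: (@integrable_tball (cst b) `|b|).
  by move=> t _; apply: ub; case: (selP cK bK (rV_of_tuple t)) => -[].
have [->|Vn0] := eqVneq V 0; first by rewrite !mulr0.
by rewrite mulrC mulfK.
Qed.

End SteinerPoint.

(** * The conjugate epigraph *)

Section Epigraph.
Context {R : realType} {n : nat}.
Implicit Types (f g : 'rV[R]_n -> R) (u w a b : 'rV[R]_(n + 1)).
Implicit Types (p q v : 'rV[R]_n).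

Definition height u : R := rsubmx u 0 0.

Definition point v (s : R) : 'rV[R]_(n + 1) := row_mx v s%:M.

Lemma lsubmx_point v s : lsubmx (point v s) = v.
Proof. exact: row_mxKl. Qed.

Lemma height_point v s : height (point v s) = s.
Proof. by rewrite /height row_mxKr mxE eqxx mulr1n. Qed.

Lemma heightB u w : height (u - w) = height u - height w.
Proof. by rewrite /height linearB !mxE. Qed.

Lemma lsubmxB u w : lsubmx (u - w) = lsubmx u - lsubmx w.
Proof. by apply/rowP => j; rewrite !mxE. Qed.

Lemma dotv_split u w :
  dotv u w = dotv (lsubmx u) (lsubmx w) + height u * height w.
Proof.
rewrite /dotv big_split_ord /= big_ord1 /height !mxE; congr (_ + _).
by apply: eq_bigr => i _; rewrite !mxE.
Qed.

Lemma enorm_lsubmx_le u : enorm (lsubmx u) <= enorm u.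
Proof.
rewrite enorm_leE ?enorm_ge0// enorm_sqr dotv_split lerDl.
by rewrite -expr2 sqr_ge0.
Qed.

Lemma norm_height_le u : `|height u| <= enorm u.
Proof.
rewrite -ler_sqr ?nnegrE ?enorm_ge0// enorm_sqr dotv_split.
by rewrite real_normK ?num_real// -expr2 lerDr dotv_ge0.
Qed.

Lemma lsubmx_continuous : continuous (fun u : 'rV[R]_(n + 1) => lsubmx u).
Proof.
apply: (@enorm_lipschitz_continuous _ _ _ 1) => // x y.
by rewrite mul1r -linearB; exact: enorm_lsubmx_le.
Qed.

Lemma height_continuous : continuous height.
Proof.
move=> u; rewrite /continuous_at /height.
under eq_cvg do rewrite mxE; rewrite mxE; exact: coord_continuous.
Qed.

Definition convex_fun f := forall x y c, 0 <= c <= 1 ->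
  f (x + c *: (y - x)) <= (1 - c) * f x + c * f y.

Lemma convex_functionW f : convex_function setT f -> convex_fun f.
Proof.
move=> cf x y c /andP[c0 c1]; have := cf (Itv01 c0 c1) y x.
rewrite !inE => /(_ Logic.I Logic.I).
have -> : conv (Itv01 c0 c1) (y : convex_lmodType _) x = c *: y + (1 - c) *: x.
  by [].
have -> : conv (Itv01 c0 c1) (f y : R^o) (f x) = c * f y + (1 - c) * f x by [].
rewrite (addrC (c * _)); congr (f _ <= _).
by apply/rowP => i; rewrite !mxE; ring.
Qed.

Definition epi f := [set u : 'rV[R]_(n + 1) | f (lsubmx u) <= height u].

(** The epigraph of the convex conjugate, as an intersection of half-spaces. *)
Definition conj_epi f := [set u : 'rV[R]_(n + 1) |
  forall p, dotv (lsubmx u) p - f p <= height u].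

Lemma epi_closed_convex f : continuous f -> convex_fun f ->
  closed_convex (epi f).
Proof.
move=> cf vf; split.
- by exists (point 0 (f 0)); rewrite /epi /= lsubmx_point height_point.
- have -> : epi f = [set u | f (lsubmx u) - height u <= 0].
    by apply/seteqP; split=> u; rewrite /epi /= subr_le0.
  apply: (@closed_comp _ _ (fun u => f (lsubmx u) - height u) [set y | y <= 0]);
    last exact: closed_le.
  move=> u _; apply: (@cvgB R R _ (nbhs u) _ (fun u => f (lsubmx u)) height).
    exact: (@continuous_comp _ _ _ _ f u (@lsubmx_continuous u) (cf _)).
  exact: height_continuous.
- move=> x y c; rewrite /epi /= => fx fy c01.
  have -> : height (x + c *: (y - x)) = (1 - c) * height x + c * height y.
    by rewrite /height !mxE; ring.
  rewrite linearD linearZ linearB; apply: le_trans (vf _ _ _ c01) _.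
  by case/andP: c01 => c0 c1; rewrite lerD// ler_wpM2l//; lra.
Qed.

(** The inequality of Fenchel and Moreau, up to d.  Separate the point
    (p, f p - d) from the epigraph of f by projecting it: the normal is not
    horizontal, since otherwise the inequality tested over p would put the
    projection on the vertical line through p, below the epigraph; normalizing
    the normal gives an affine function below f. *)
Lemma affine_minorant f p (d : R) : continuous f -> convex_fun f -> 0 < d ->
  exists2 u, conj_epi f u & f p - d <= dotv (lsubmx u) p - height u.
Proof.
move=> cf vf d0; have cE := epi_closed_convex cf vf.
pose a := point p (f p - d); have [] := cprojP a cE; set z := cproj _ _.
rewrite {1}/epi /= => fz _.
have za q s : f q <= s ->
    dotv (p - lsubmx z) (q - lsubmx z) +
      (f p - d - height z) * (s - height z) <= 0.
  move=> qs; have sE : epi f (point q s).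
    by rewrite /epi /= lsubmx_point height_point.
  have := cproj_dotv a cE sE.
  by rewrite -/z dotv_split !lsubmxB !heightB /a !lsubmx_point !height_point.
set t := f p - d - height z in za.
have t0 : t < 0.
  rewrite ltNge le_eqVlt; apply/negP => /predU1P[t0|t0].
    have := za p (f p) (lexx _); rewrite -t0 mul0r addr0 => /dotv_eq0/eqP.
    rewrite subr_eq0 => /eqP pz; move: fz; rewrite -pz.
    by move: t0; rewrite /t; lra.
  have := za (lsubmx z) (height z + 1); rewrite subrr dotv0r add0r.
  by rewrite addrAC subrr add0r mulr1 => /(_ _)/wrap[]; lra.
pose v := (- t)^-1 *: (p - lsubmx z).
have vt q : dotv v q * - t = dotv (p - lsubmx z) q.
  by rewrite dotvZl mulrAC mulVf ?mul1r// oppr_eq0 lt_eqF.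
exists (point v (dotv v (lsubmx z) - height z)).
  move=> q; rewrite lsubmx_point height_point.
  have := za q (f q) (lexx _); rewrite dotvDr dotvNr -!vt; nra.
rewrite lsubmx_point height_point.
have : 0 <= dotv v p - dotv v (lsubmx z).
  by rewrite -dotvNr -dotvDr dotvZl mulr_ge0 ?dotv_ge0// invr_ge0; lra.
by move: t0; rewrite /t; lra.
Qed.

Lemma conj_epi_closed_convex f : continuous f -> convex_fun f ->
  closed_convex (conj_epi f).
Proof.
move=> cf vf; split.
- by have [u uE _] := affine_minorant 0 cf vf ltr01; exists u.
- have -> : conj_epi f = \bigcap_p [set u | dotv (point p (- 1)) u <= f p].
    apply/seteqP; split=> [u uf p _|u uf p].
      have := uf p; rewrite /= dotv_split lsubmx_point height_point dotvC; lra.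
    have := uf p I; rewrite /= dotv_split lsubmx_point height_point dotvC; lra.
  by apply: closed_bigI => p _; exact: closed_dotv_le.
- move=> x y c fx fy /andP[c0 c1] p.
  have -> : height (x + c *: (y - x)) = height x + c * (height y - height x).
    by rewrite /height !mxE.
  rewrite linearD linearZ linearB !dotvE.
  by have := fx p; have := fy p; nra.
Qed.

(** Used with r the inverse of a scaling factor that tends to infinity. *)
Lemma le_of_small_multiples (x y C : R) :
  (forall r, 0 < r -> x <= r * C + y) -> x <= y.
Proof.
move=> h; apply/ler_addgt0Pr => e e0.
have C1 : 0 < `|C| + 1 by rewrite ltr_wpDl.
have := h _ (divr_gt0 e0 C1).
have : e / (`|C| + 1) * C <= e.
  rewrite -mulrA ler_piMr ?(ltW e0)// mulrC ler_pdivrMr// mul1r.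
  by have := ler_norm C; lra.
by lra.
Qed.

(** Project a point a of the first epigraph to b in the second one and let
    (p, t) = a - b, so that t <= 0.  When t < 0, the slope q = p / (- t) is one
    at which b attains the biconjugate of g, so that
    g q <= <q, b> - height b, while <q, a> - height a <= f q because a is in the
    first epigraph; subtracting gives |a - b| ^ 2 <= e (|t| + |p|).
    When t = 0, the same comparison along the slopes p / r with r tending to 0
    leaves |p| ^ 2 <= e |p|. *)
Lemma conj_epi_near f g e :
  continuous f -> convex_fun f -> continuous g -> convex_fun g ->
  (forall p, `|f p - g p| <= e * (1 + enorm p)) ->
  near_set (conj_epi f) (conj_epi g) (2 * e).
Proof.
move=> cf vf cg vg fg a fa; have cE := conj_epi_closed_convex cg vg.
have [] := cprojP a cE; set b := cproj _ _ => gb _; exists b => //.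
have e0 : 0 <= e.
  by have := fg 0; rewrite enorm0 addr0 mulr1; apply: le_trans.
set p := lsubmx (a - b); set t := height (a - b).
have ab w : conj_epi g w ->
    dotv p (lsubmx w) + t * height w <= dotv p (lsubmx b) + t * height b.
  move=> gw; have := cproj_dotv a cE gw; rewrite -/b dotv_split -/p -/t.
  by rewrite linearB heightB dotvDr dotvNr; lra.
have t0 : t <= 0.
  have := ab (point (lsubmx b) (height b + 1)).
  rewrite lsubmx_point height_point => /(_ _)/wrap[].
    by move=> q; rewrite lsubmx_point height_point; have := gb q; lra.
  by lra.
have pt : enorm (a - b) ^+ 2 = dotv p p + t ^+ 2.
  by rewrite enorm_sqr dotv_split expr2.
have fga q : dotv q (lsubmx a) - height a <= g q + e * (1 + enorm q).
  have := fa q; have := fg q; rewrite (dotvC q) ler_norml => /andP[_]; lra.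
have pab : dotv p p = dotv p (lsubmx a) - dotv p (lsubmx b).
  by rewrite {2}/p linearB dotvDr dotvNr.
have tab : t = height a - height b by rewrite /t heightB.
have N0 := enorm_ge0 (a - b).
suff : enorm (a - b) ^+ 2 <= e * (- t + enorm p).
  have := enorm_lsubmx_le (a - b); have := norm_height_le (a - b).
  rewrite -/p -/t ler0_norm//; nra.
rewrite {}pt; move: t0; rewrite le_eqVlt => /predU1P[t0|t0].
  rewrite t0 expr0n /= addr0 oppr0 add0r.
  apply: (@le_of_small_multiples _ _ (height a + g 0 + e)) => r r0.
  set q := r^-1 *: p.
  have rq (w : 'rV[R]_n) : r * dotv q w = dotv p w.
    by rewrite dotvZl mulVKf// gt_eqF.
  have gq : g q <= dotv q (lsubmx b) + g 0.
    apply/ler_addgt0Pr => d d0; have [w gw qw] := affine_minorant q cg vg d0.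
    have := ab _ gw; rewrite t0 !mul0r !addr0 -!rq (ler_pM2l r0).
    by have := gw 0; rewrite dotv0r; move: qw; rewrite dotvC; lra.
  have qn : r * enorm q = enorm p.
    by rewrite enormZ gtr0_norm ?invr_gt0// mulVKf// gt_eqF.
  have := fga q; rewrite pab -!rq -qn.
  by have := gq; nra.
set r := - t; have r0 : 0 < r by rewrite oppr_gt0.
set q := r^-1 *: p.
have rq (w : 'rV[R]_n) : r * dotv q w = dotv p w.
  by rewrite dotvZl mulVKf// gt_eqF.
have qn : r * enorm q = enorm p.
  by rewrite enormZ gtr0_norm ?invr_gt0// mulVKf// gt_eqF.
have gq : g q <= dotv q (lsubmx b) - height b.
  apply/ler_addgt0Pr => d d0; have [w gw qw] := affine_minorant q cg vg d0.
  suff : dotv q (lsubmx w) - height w <= dotv q (lsubmx b) - height b.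
    by move: qw; rewrite dotvC; lra.
  rewrite -(ler_pM2l r0) !mulrBr !rq /r.
  by have := ab _ gw; lra.
have key : dotv q (lsubmx a) - height a - (dotv q (lsubmx b) - height b) <=
    e * (1 + enorm q) by have := fga q; lra.
have -> : t ^+ 2 = - (r * (height a - height b)) by rewrite -tab /r; ring.
have := ler_wpM2l (ltW r0) key; rewrite pab -!rq -qn; lra.
Qed.

(** On the ray spanned by the velocity v, the term <v, p> grows at the rate |v|
    and f at most at the rate c, while their difference stays bounded. *)
Lemma conj_epi_lsubmx_le f c u : conj_epi f u -> 0 <= c ->
  (forall p q, `|f p - f q| <= c * enorm (p - q)) -> enorm (lsubmx u) <= c.
Proof.
move=> fu c0 fc; set v := lsubmx u.
have : enorm v ^+ 2 <= c * enorm v.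
  apply: (@le_of_small_multiples _ _ (height u + f 0)) => r r0.
  have rr (x : R) : r * (r^-1 * x) = x by rewrite mulVKf// gt_eqF.
  have := le_trans (ler_norm _) (fc (r^-1 *: v) 0); have := fu (r^-1 *: v).
  rewrite -/v subr0 enormZ (gtr0_norm (_ : 0 < r^-1)) ?invr_gt0//.
  rewrite dotvZr -enorm_sqr.
  have := rr (enorm v); have := rr (enorm v ^+ 2).
  move: (r^-1 * _) (r^-1 * _) => x y <- <- h1 h2; nra.
by have := enorm_ge0 v; nra.
Qed.

End Epigraph.

Lemma enorm_le_coord (R : realType) m (u : 'rV[R]_m) b : 0 <= b ->
  (forall i, `|u 0 i| <= b) -> enorm u <= m%:R * b.
Proof.
move=> b0 ub; rewrite enorm_leE; last by rewrite mulr_ge0.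
apply: (@le_trans _ _ (m%:R * b ^+ 2)).
  rewrite mulr_natl -[m in leRHS]card_ord -sumr_const; apply: ler_sum => i _.
  by rewrite -expr2 -real_normK ?num_real// lerXn2r ?nnegrE.
rewrite exprMn ler_wpM2r ?sqr_ge0// expr2 -natrM ler_nat.
by case: (m) => // k; rewrite leq_pmulr.
Qed.

(** * Stability of the canonical representation *)

Section CanonicalStability.
Context {R : realType} {n : nat}.
Implicit Types (H G : R -> 'rV[R]_n -> 'rV[R]_n -> R) (a : 'rV[R]_(n + 1)).

Lemma epi_lagrangianE H t x : epi_lagrangian H t x = conj_epi (H t x).
Proof.
apply/seteqP; split=> u.
  move=> hu p; rewrite -lee_fin; apply: le_trans hu.
  by apply: ereal_sup_ubound; exists p.
by move=> hu; apply: ge_ereal_sup => _ [p _ <-]; rewrite lee_fin; exact: hu.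
Qed.

Definition continuous_convex (f : 'rV[R]_n -> R) :=
  continuous f /\ convex_fun f.

Lemma admissible_continuous_convex T H t x : admissible T H -> t \in `[0, T] ->
  continuous_convex (H t x).
Proof.
move=> [_ cH vH _] tT; split; last exact: convex_functionW (vH _ _ tT).
move=> p; have := cH t tT (x, p).
move=> /(@continuous_comp _ _ _ (fun q => (x, q)) (fun z => H t z.1 z.2) p).
apply; exact: (@cvg_pair _ _ _ (nbhs p) (nbhs x) (nbhs p) (nbhs_filter p)
  (nbhs_filter x) (nbhs_filter p) (fun=> x) id (cvg_cst x) cvg_id).
Qed.

Lemma canonical_eE H t x a :
  canonical_e H t x a = steiner (truncate (conj_epi (H t x)) a).
Proof. by rewrite /canonical_e epi_lagrangianE. Qed.

(** 40 collects 2 from conj_epi_near, 10 from near_truncate and 2 from the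
    two ends of a chord in ball_gradient. *)
Definition stability_const : R :=
  (fine (lebesgue_tuple (n + 1) (@tball R (n + 1))))^-1 * (40 * 2 ^+ (n + 1)).

Lemma stability_const_ge0 : 0 <= stability_const.
Proof.
by rewrite mulr_ge0 ?invr_ge0 ?fine_ge0// mulr_ge0// exprn_ge0.
Qed.

(** The constant is independent of t, x and a, although the truncated epigraphs
    grow without bound with a. *)
Lemma canonical_e_near H G t x a e i :
  continuous_convex (H t x) -> continuous_convex (G t x) -> 0 < e ->
  (forall p, `|H t x p - G t x p| <= e * (1 + enorm p)) ->
  `|canonical_e H t x a 0 i - canonical_e G t x a 0 i| <= stability_const * e.
Proof.
move=> [cf vf] [cg vg] e0 fg; rewrite !canonical_eE.
have cF := conj_epi_closed_convex cf vf.
have cG := conj_epi_closed_convex cg vg.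
have FG := conj_epi_near cf vf cg vg fg.
have gf p : `|G t x p - H t x p| <= e * (1 + enorm p) by rewrite distrC.
have GF := conj_epi_near cg vg cf vf gf.
have e2 : 0 < 2 * e by lra.
have FGa := @near_truncate _ _ _ _ a _ e2 cF cG FG GF.
have GFa := @near_truncate _ _ _ _ a _ e2 cG cF GF FG.
set dF := enorm a + 2 * Defs.edist a (conj_epi (H t x)).
set dG := enorm a + 2 * Defs.edist a (conj_epi (G t x)).
apply: le_trans (@steiner_coord_lipschitz _ _ _ _ (Num.max dF dG)
  (10 * (2 * e)) i (truncateP a cF) (truncateP a cG) _ _ _ FGa GFa) _.
- by move=> z /truncate_bounded zF; rewrite le_max zF.
- by move=> z /truncate_bounded zF; rewrite le_max zF orbT.
- by lra.
by rewrite /stability_const le_eqVlt; apply/orP; left; apply/eqP; ring.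
Qed.

(** Test the Steiner point against its own velocity, using that all the
    velocities in the epigraph have norm at most c. *)
Lemma canonical_f_le H t x a c : continuous_convex (H t x) -> 0 <= c ->
  (forall p q, `|H t x p - H t x q| <= c * enorm (p - q)) ->
  enorm (canonical_f H t x a) <= c.
Proof.
move=> [cf vf] c0 fc; rewrite /canonical_f canonical_eE.
have cF := conj_epi_closed_convex cf vf; set s := steiner _.
have := @dotv_steiner_le _ _ _ _ (point (lsubmx s) 0) (c * enorm (lsubmx s))
  (truncateP a cF) (@truncate_bounded _ _ _ a).
rewrite -/s dotv_split lsubmx_point height_point mul0r addr0 -enorm_sqr.
rewrite mulr_ge0 ?enorm_ge0// => /(_ isT) le_s.
have : enorm (lsubmx s) ^+ 2 <= c * enorm (lsubmx s).
  apply: le_s => z [zF _].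
  rewrite dotv_split lsubmx_point height_point mul0r addr0.
  apply: le_trans (dotv_le_enorm _ _) _.
  by rewrite mulrC ler_wpM2r ?enorm_ge0// (conj_epi_lsubmx_le zF c0 fc).
by have := enorm_ge0 (lsubmx s); nra.
Qed.

End CanonicalStability.

Lemma cvg0_le_near (R : realType) (F : nat -> \bar R) (e : R) : 0 < e ->
  F @ \oo --> 0%E -> \forall i \near \oo, (F i <= e%:E)%E.
Proof.
move=> e0 F0; have := F0 _ (@open_ereal_lt' _ 0%E e%:E _).
rewrite lte_fin => /(_ e0).
by apply: (@filterS _ (nbhs \oo) _ (fun i => (F i < e%:E)%E)) => i; exact: ltW.
Qed.

Lemma le_near_cvg0 (R : realType) (F : nat -> \bar R) :
  (forall i, 0 <= F i)%E ->
  (forall e : R, 0 < e -> \forall i \near \oo, (F i <= e%:E)%E) ->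
  F @ \oo --> 0%E.
Proof.
move=> F0 Fe; apply/fine_cvgP; split.
  have := Fe 1 ltr01; apply: filterS => i Fi.
  by rewrite ge0_fin_numE// (le_lt_trans Fi)// ltry.
apply/cvgrPdist_le => e e0; have := Fe e e0; apply: filterS => i Fi /=.
rewrite sub0r normrN ger0_norm ?fine_ge0// -lee_fin fineK//.
by rewrite ge0_fin_numE// (le_lt_trans Fi)// ltry.
Qed.

Section Uniform.
Context {R : realType} {n : nat}.
Implicit Types (H : R -> 'rV[R]_n -> 'rV[R]_n -> R).

Lemma canonical_fB_coord H G t x a j :
  (canonical_f H t x a - canonical_f G t x a) 0 j =
  canonical_e H t x a 0 (lshift 1 j) - canonical_e G t x a 0 (lshift 1 j).
Proof.
rewrite /canonical_f; move: (canonical_e H t x a) (canonical_e G t x a) => u w.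
by rewrite !mxE.
Qed.

Lemma canonical_l_coord H t x a :
  canonical_l H t x a = canonical_e H t x a 0 (rshift n 0).
Proof.
by rewrite /canonical_l; move: (canonical_e H t x a) => u; rewrite mxE.
Qed.

Lemma canonical_e_cvg (T r : R) (H_ : nat -> R -> 'rV[R]_n -> 'rV[R]_n -> R)
    H (e : R) :
  (forall i, admissible T (H_ i)) -> admissible T H -> 0 < e ->
  (fun i : nat => ereal_sup
    [set (`|H_ i z.1.1 z.1.2 z.2 - H z.1.1 z.1.2 z.2| / (1 + enorm z.2))%:E
      | z in `[0, T] `*` cball 0 r `*` [set: 'rV[R]_n]]) @ \oo --> 0%E ->
  \forall i \near \oo, forall t x a j, t \in `[0, T] -> cball 0 r x ->
    `|canonical_e (H_ i) t x a 0 j - canonical_e H t x a 0 j| <= e.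
Proof.
move=> H_adm Hadm e0 hyp.
have K0 := @stability_const_ge0 R n; set K := stability_const in K0.
have K1 : 0 < K + 1 by lra.
have d0 : 0 < e / (K + 1) by rewrite divr_gt0.
have := cvg0_le_near d0 hyp; apply: filterS => i le_d t x a j tT xr.
have := @canonical_e_near _ _ (H_ i) H t x a _ j
  (admissible_continuous_convex x (H_adm i) tT)
  (admissible_continuous_convex x Hadm tT) d0.
rewrite -/K => /(_ _)/wrap[].
  move=> p; have p1 : 0 < 1 + enorm p by have := enorm_ge0 p; lra.
  rewrite -ler_pdivrMr// -lee_fin; apply: le_trans le_d.
  by apply: ereal_sup_ubound; exists (t, x, p).
move=> /le_trans; apply.
by rewrite mulrA ler_pdivrMr//; nra.
Qed.

End Uniform.

Theorem theorem3p13 (R : realType) (n : nat) (T : R) (T_gt0 : 0 < T)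
    (H_ : nat -> R -> 'rV[R]_n -> 'rV[R]_n -> R)
    (H : R -> 'rV[R]_n -> 'rV[R]_n -> R)
    (H_cont : forall i : nat,
      {within `[0, T] `*` [set: 'rV[R]_n] `*` [set: 'rV[R]_n],
        continuous (fun z : R * 'rV[R]_n * 'rV[R]_n => H_ i z.1.1 z.1.2 z.2)})
    (Hcont : {within `[0, T] `*` [set: 'rV[R]_n] `*` [set: 'rV[R]_n],
        continuous (fun z : R * 'rV[R]_n * 'rV[R]_n => H z.1.1 z.1.2 z.2)})
    (H_adm : forall i : nat, admissible T (H_ i))
    (Hadm : admissible T H) :
  ((forall r : R, 0 < r ->
      (fun i : nat => ereal_sup
        [set (`|H_ i z.1.1 z.1.2 z.2 - H z.1.1 z.1.2 z.2|
                / (1 + enorm z.2))%:E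
        | z in `[0, T] `*` cball 0 r `*` [set: 'rV[R]_n]]) @ \oo --> 0%E) ->
    forall r : R, 0 < r ->
      ((fun i : nat => ereal_sup
        [set (enorm (canonical_f (H_ i) z.1.1 z.1.2 z.2
                - canonical_f H z.1.1 z.1.2 z.2))%:E
        | z in `[0, T] `*` cball 0 r `*` [set: 'rV[R]_(n + 1)]])
        @ \oo --> 0%E) /\
      ((fun i : nat => ereal_sup
        [set `|canonical_l (H_ i) z.1.1 z.1.2 z.2
                - canonical_l H z.1.1 z.1.2 z.2|%:E
        | z in `[0, T] `*` cball 0 r `*` [set: 'rV[R]_(n + 1)]])
        @ \oo --> 0%E)) /\
  (forall (c_ : nat -> R -> R) (c : R -> R),
    (forall i : nat, lebesgue_measurable_fun `[0, T] (c_ i)) ->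
    lebesgue_measurable_fun `[0, T] c ->
    (forall (i : nat) (t : R), t \in `[0, T] -> 0 <= c_ i t) ->
    (forall t : R, t \in `[0, T] -> 0 <= c t) ->
    (forall (i : nat) (t : R) (x p q : 'rV[R]_n), t \in `[0, T] ->
      `|H_ i t x p - H_ i t x q| <=
        c_ i t * (1 + enorm x) * enorm (p - q)) ->
    (forall (t : R) (x p q : 'rV[R]_n), t \in `[0, T] ->
      `|H t x p - H t x q| <= c t * (1 + enorm x) * enorm (p - q)) ->
    (forall (i : nat) (t : R) (x : 'rV[R]_n) (a : 'rV[R]_(n + 1)),
      t \in `[0, T] ->
      enorm (canonical_f (H_ i) t x a) <= c_ i t * (1 + enorm x)) /\
    (forall (t : R) (x : 'rV[R]_n) (a : 'rV[R]_(n + 1)),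
      t \in `[0, T] ->
      enorm (canonical_f H t x a) <= c t * (1 + enorm x))).

Proof.
split.
  move=> hyp r r0.
  have T0 : (0 : R) \in `[0, T] by rewrite in_itv /= lexx ltW.
  have x0 : cball (0 : 'rV[R]_n) r 0 by rewrite /cball /= subrr enorm0 ltW.
  have near_e e : 0 < e -> _ := fun e0 =>
    @canonical_e_cvg R n T r H_ H e H_adm Hadm e0 (hyp r r0).
  split.
    apply: le_near_cvg0 => [i|e e0].
      apply: le_trans (ereal_sup_ubound _); last by exists (0, 0, 0).
      by rewrite lee_fin enorm_ge0.
    have n1 : 0 < n%:R + 1 :> R by rewrite ltr_wpDl.
    have := near_e _ (divr_gt0 e0 n1); apply: filterS => i le_e.
    apply: ge_ereal_sup => _ [[[t x] a] [[/= tT xr] _] <-]; rewrite lee_fin.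
    apply: le_trans (@enorm_le_coord _ _ _ (e / (n%:R + 1)) _ _) _.
    - by rewrite ltW// divr_gt0.
    - by move=> j; rewrite canonical_fB_coord; exact: (le_e t x a _ tT xr).
    - by rewrite mulrA ler_pdivrMr//; nra.
  apply: le_near_cvg0 => [i|e e0].
    apply: le_trans (ereal_sup_ubound _); last by exists (0, 0, 0).
    by rewrite lee_fin normr_ge0.
  have := near_e _ e0; apply: filterS => i le_e.
  apply: ge_ereal_sup => _ [[[t x] a] [[/= tT xr] _] <-]; rewrite lee_fin.
  by rewrite !canonical_l_coord; exact: (le_e t x a _ tT xr).
move=> c_ c _ _ c_0 c0 H_lip Hlip.
have x1 (x : 'rV[R]_n) : 0 <= 1 + enorm x by have := enorm_ge0 x; lra.
split=> [i t x a tT|t x a tT].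
  apply: canonical_f_le => [||p q].
  - exact: admissible_continuous_convex (H_adm i) tT.
  - by rewrite mulr_ge0// c_0.
  - exact: H_lip.
apply: canonical_f_le => [||p q].
- exact: admissible_continuous_convex Hadm tT.
- by rewrite mulr_ge0// c0.
- exact: Hlip.
Qed.
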